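(* Let $1\le p<\infty$ and $g\in H(\mathbb{D})$. Then the integral operator $I_g: S_2^p\to S_2^p$, $I_gf(z)=\int_0^z f'(w)g(w)\,dw$, is bounded if and only if $g\in S^p$.
   Context: $\mathbb{D}$ is the open unit disc, $H(\mathbb{D})$ the space of analytic functions on $\mathbb{D}$. For $1\le p<\infty$, $H^p$ is the Hardy space of $f\in H(\mathbb{D})$ with $\|f\|_{H^p}^p=\sup_{0<r<1}\frac{1}{2\pi}\int_0^{2\pi}|f(re^{i\theta})|^p\,d\theta<\infty$. $S^p=\{f\in H(\mathbb{D}): f'\in H^p\}$ with norm $\|f\|_{S^p}=|f(0)|+\|f'\|_{H^p}$. $S_2^p=\{f\in H(\mathbb{D}): f''\in H^p\}$ with norm $\|f\|_{S_2^p}=|f(0)|+|f'(0)|+\|f''\|_{H^p}$. *)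

(* Defs.v *)
From Stdlib Require Import Reals.
From Coquelicot Require Import Coquelicot.
Open Scope R_scope.

(* x ^ p for x >= 0 and real p > 0 (with 0 ^ p = 0). *)
Definition rpow (x p : R) : R := if Rle_dec x 0 then 0 else Rpower x p.

Definition analytic (f : C -> C) : Prop :=
  forall z : C, Cmod z < 1 -> ex_derive (K := C_AbsRing) f z.

(* the complex derivative f' (meaningful on D when f is analytic) *)
Definition cderiv (f : C -> C) : C -> C := C_derive f.

Definition polar (r t : R) : C := (r * cos t, r * sin t).

Definition Mp (p : R) (f : C -> C) (r : R) : R :=
  / (2 * PI) * RInt (fun t => rpow (Cmod (f (polar r t))) p) 0 (2 * PI).

Definition Hp_sup (p : R) (f : C -> C) : Rbar :=
  Lub_Rbar (fun x => exists r, 0 < r < 1 /\ x = Mp p f r).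

Definition in_Hp (p : R) (f : C -> C) : Prop :=
  analytic f /\ is_finite (Hp_sup p f).

Definition Hp_norm (p : R) (f : C -> C) : R := rpow (real (Hp_sup p f)) (/ p).

Definition in_Sp (p : R) (f : C -> C) : Prop :=
  analytic f /\ in_Hp p (cderiv f).

Definition Sp_norm (p : R) (f : C -> C) : R :=
  Cmod (f (RtoC 0)) + Hp_norm p (cderiv f).

Definition in_S2p (p : R) (f : C -> C) : Prop :=
  analytic f /\ in_Hp p (cderiv (cderiv f)).

Definition S2p_norm (p : R) (f : C -> C) : R :=
  Cmod (f (RtoC 0)) + Cmod (cderiv f (RtoC 0)) + Hp_norm p (cderiv (cderiv f)).

(* I_g f (z) = \int_0^z f'(w) g(w) dw, integrated along the segment [0,z]:
   \int_0^1 f'(t z) g(t z) z dt *)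
Definition Ig (g f : C -> C) : C -> C :=
  fun z => @RInt C_R_CompleteNormedModule
             (fun t => Cmult (Cmult (cderiv f (Cmult (RtoC t) z)) (g (Cmult (RtoC t) z))) z)
             0 1.

Definition Ig_bounded_S2p (p : R) (g : C -> C) : Prop :=
  exists K : R, forall f : C -> C, in_S2p p f ->
    in_S2p p (Ig g f) /\ S2p_norm p (Ig g f) <= K * S2p_norm p f.

(* Main.v *)
Require Import Defs.
From Stdlib Require Import Reals Lra ClassicalEpsilon.
From Coquelicot Require Import Coquelicot.
Open Scope R_scope.

(* Since [(I_g f)'' = f'' g + f' g'], taking [f(z) = z] shows that boundedness forces [g'] to lie
   in [H^p].  Conversely a function with derivative in [H^p] is bounded on the disc by
   [|f(0)| + 4 pi ||f'||]: on a circle it differs from its mean [f(0)] by at most its total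
   variation there, an integral of [|f'|].  This applied to [g] and to [f'] bounds both summands
   of [(I_g f)''] in [H^p].
   Analyticity is mere complex differentiability here, so the formula for [(I_g f)''] rests on
   Goursat's theorem (which gives [(I_g f)' = f' g]) and on the analyticity of derivatives,
   obtained by writing a primitive as its own mean over circles of a fixed radius and
   differentiating under the integral. *)

(** Differentiability of [f] says nothing yet about continuity of [f'], while the fundamental
    theorem on a path and differentiation under the integral both ask for a continuous derivative. A
    primitive [F] avoids the obstacle: its derivative [f] is differentiable, hence continuous.
    Integrating [F(z + r e^(it)) e^(-int)] over circles of fixed radius about a moving centre [z]
    gives functions whose [z]-derivatives are again of this kind, since integration by parts moves
    the derivative from [F] onto the exponential. This takes the place of Cauchy's formula, without
    the kernel [1/(w - z)]. The constants come from elementary bounds. In [4 pi], a factor [2 pi]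
    turns the mean over a circle into an integral, and the other [2] is the price of passing from
    [H^p] to [H^1] without Jensen's inequality. Minkowski's inequality is replaced by an estimate of
    sums that costs a factor [4]. *)

Local Notation Cu := (AbsRing_UniformSpace C_AbsRing).

(** * Derivatives and paths *)

Lemma Cmod_minus_sym (a b : C) : Cmod (a - b) = Cmod (b - a).
Proof. rewrite <- Cmod_opp. f_equal. ring. Qed.

Lemma Cmod_minus_le (a b : C) : Cmod a - Cmod b <= Cmod (a - b).
Proof.
  pose proof (Cmod_triangle (a - b) b) as H.
  replace (a - b + b)%C with a in H by ring. lra.
Qed.

Lemma Cmod_minus_triangle (a b c : C) : Cmod (a - c) <= Cmod (a - b) + Cmod (b - c).
Proof.
  replace (a - c)%C with ((a - b) + (b - c))%C by ring. apply Cmod_triangle.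
Qed.

Lemma Cmod_le_abs (z : C) : Cmod z <= Rabs (fst z) + Rabs (snd z).
Proof.
  destruct z as [x y]; simpl.
  replace (x, y) with (RtoC x + (0, y))%C by (apply injective_projections; simpl; ring).
  eapply Rle_trans; [apply Cmod_triangle|]. rewrite Cmod_R.
  replace (Cmod (0, y)) with (Rabs y); [lra|].
  replace (0, y) with (Ci * RtoC y)%C by (apply injective_projections; simpl; ring).
  rewrite Cmod_mult, Cmod_Ci, Cmod_R. ring.
Qed.

Section Wrt.
Context {X : UniformSpace}.
Implicit Types (f g : X -> C) (x : X).

Lemma continuous_Cu_eps f x :
  @continuous X Cu f x <-> forall eps, 0 < eps -> locally x (fun y => Cmod (f y - f x) < eps).
Proof.
  unfold continuous; rewrite filterlim_locally. split.
  - intros H eps He. exact (H (mkposreal eps He)).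
  - intros H eps. exact (H eps (cond_pos eps)).
Qed.

Lemma continuous_Cplus f g x :
  @continuous X Cu f x -> @continuous X Cu g x -> @continuous X Cu (fun y => f y + g y)%C x.
Proof.
  exact (@continuous_plus X C_AbsRing (AbsRing_NormedModule C_AbsRing) f g x).
Qed.

Lemma continuous_Cmult f g x :
  @continuous X Cu f x -> @continuous X Cu g x -> @continuous X Cu (fun y => f y * g y)%C x.
Proof. exact (@continuous_mult X C_AbsRing f g x). Qed.

Lemma continuous_Cconst (c : C) x : @continuous X Cu (fun _ => c) x.
Proof. exact (@continuous_const X Cu c x). Qed.

Lemma continuous_Cminus f g x :
  @continuous X Cu f x -> @continuous X Cu g x -> @continuous X Cu (fun y => f y - g y)%C x.
Proof.
  exact (@continuous_minus X C_AbsRing (AbsRing_NormedModule C_AbsRing) f g x).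
Qed.

Lemma continuous_Cmod f x :
  @continuous X Cu f x -> continuous (fun y => Cmod (f y)) x.
Proof.
  intros H. unfold continuous; apply filterlim_locally. intros eps.
  generalize (proj1 (continuous_Cu_eps f x) H eps (cond_pos eps)).
  apply filter_imp. intros y Hy. change (Rabs (Cmod (f y) - Cmod (f x)) < eps).
  pose proof (Cmod_minus_le (f y) (f x)). pose proof (Cmod_minus_le (f x) (f y)).
  rewrite (Cmod_minus_sym (f x)) in *. apply Rabs_def1; lra.
Qed.

(* Caratheodory's form of the derivative, with respect to a coordinate [iota]: the identity of C
   for complex derivatives and [RtoC] for derivatives of paths.  It reduces the product and chain
   rules to continuity. *)
Definition is_derive_wrt (iota f : X -> C) (x : X) (l : C) : Prop :=
  exists q : X -> C, @continuous X Cu q x /\ q x = l /\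
    forall y, f y = (f x + q y * (iota y - iota x))%C.

Variable iota : X -> C.

Lemma is_derive_wrt_continuous f x l :
  @continuous X Cu iota x -> is_derive_wrt iota f x l -> @continuous X Cu f x.
Proof.
  intros Hi (q & Hq & _ & E).
  apply (@continuous_ext X Cu (fun y => f x + q y * (iota y - iota x))%C).
  { intros y. symmetry; apply E. }
  apply continuous_Cplus; [apply continuous_Cconst|].
  apply continuous_Cmult; [exact Hq|].
  apply continuous_Cminus; [exact Hi|apply continuous_Cconst].
Qed.

Lemma is_derive_wrt_const (c : C) x : is_derive_wrt iota (fun _ => c) x 0%C.
Proof.
  exists (fun _ => 0%C). split; [apply continuous_Cconst|]. split; [reflexivity|].
  intros y; ring.
Qed.

Lemma is_derive_wrt_id x : is_derive_wrt iota iota x 1%C.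
Proof.
  exists (fun _ => 1%C). split; [apply continuous_Cconst|]. split; [reflexivity|].
  intros y; ring.
Qed.

Lemma is_derive_wrt_plus f g x lf lg :
  is_derive_wrt iota f x lf -> is_derive_wrt iota g x lg ->
  is_derive_wrt iota (fun y => f y + g y)%C x (lf + lg)%C.
Proof.
  intros (q & Hq & Eq & E) (r & Hr & Er & F).
  exists (fun y => q y + r y)%C. split; [apply continuous_Cplus; assumption|].
  split; [rewrite Eq, Er; reflexivity|]. intros y. rewrite (E y), (F y). ring.
Qed.

Lemma is_derive_wrt_mult f g x lf lg :
  @continuous X Cu iota x ->
  is_derive_wrt iota f x lf -> is_derive_wrt iota g x lg ->
  is_derive_wrt iota (fun y => f y * g y)%C x (lf * g x + f x * lg)%C.
Proof.
  intros Hi Hf Hg.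
  pose proof (is_derive_wrt_continuous _ _ _ Hi Hg) as Cg.
  destruct Hf as (q & Hq & Eq & E), Hg as (r & Hr & Er & F).
  exists (fun y => q y * g y + f x * r y)%C. split; [|split].
  - apply continuous_Cplus; apply continuous_Cmult; try assumption. apply continuous_Cconst.
  - rewrite Eq, Er; reflexivity.
  - intros y. rewrite (E y), (F y). ring.
Qed.

Lemma is_derive_wrt_scal (c : C) f x l :
  is_derive_wrt iota f x l -> is_derive_wrt iota (fun y => c * f y)%C x (c * l)%C.
Proof.
  intros (q & Hq & Eq & E). exists (fun y => c * q y)%C. split; [|split].
  - apply continuous_Cmult; [apply continuous_Cconst|assumption].
  - rewrite Eq; reflexivity.
  - intros y. rewrite (E y). ring.
Qed.

Lemma is_derive_wrt_eps f x l :
  @continuous X Cu iota x -> is_derive_wrt iota f x l -> forall eps, 0 < eps ->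
  locally x (fun y => Cmod (f y - f x - l * (iota y - iota x)) <= eps * Cmod (iota y - iota x)).
Proof.
  intros Hi (q & Hq & Eq & E) eps He.
  generalize (proj1 (continuous_Cu_eps q x) Hq eps He). apply filter_imp. intros y Hy.
  rewrite (E y).
  replace (f x + q y * (iota y - iota x) - f x - l * (iota y - iota x))%C
    with ((q y - q x) * (iota y - iota x))%C by (rewrite Eq; ring).
  rewrite Cmod_mult. apply Rmult_le_compat_r; [apply Cmod_ge_0|lra].
Qed.

(** The factor is the difference quotient, completed by the value [l] at [x]. Injectivity of [iota]
    at [x] keeps the denominator nonzero at all other points. *)
Lemma is_derive_wrt_of_eps f x l :
  (forall y, iota y = iota x -> y = x) ->
  (forall eps, 0 < eps ->
    locally x (fun y =>
      Cmod (f y - f x - l * (iota y - iota x)) <= eps * Cmod (iota y - iota x))) ->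
  is_derive_wrt iota f x l.
Proof.
  intros Hinj H.
  exists (fun y => if excluded_middle_informative (y = x) then l
                   else (f y - f x) / (iota y - iota x))%C.
  assert (Ex : (if excluded_middle_informative (x = x) then l
                else (f x - f x) / (iota x - iota x))%C = l).
  { destruct (excluded_middle_informative (x = x)); [reflexivity|congruence]. }
  assert (Hnz : forall y, y <> x -> (iota y - iota x)%C <> 0%C).
  { intros y Hy H0. apply Hy, Hinj.
    replace (iota y) with ((iota y - iota x) + iota x)%C by ring. rewrite H0; ring. }
  split; [|split; [exact Ex|]].
  - apply continuous_Cu_eps. intros eps He.
    generalize (H (eps / 2) ltac:(lra)). apply filter_imp. intros y Hy. cbv beta. rewrite Ex.
    destruct (excluded_middle_informative (y = x)) as [->|Hn].
    { replace (l - l)%C with (RtoC 0) by ring. rewrite Cmod_0; lra. }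
    specialize (Hnz y Hn). pose proof (proj1 (Cmod_gt_0 _) Hnz) as Hp.
    replace ((f y - f x) / (iota y - iota x) - l)%C
      with ((f y - f x - l * (iota y - iota x)) / (iota y - iota x))%C by (field; exact Hnz).
    rewrite Cmod_div by exact Hnz.
    apply Rle_lt_trans with (eps / 2); [|lra].
    apply Rle_div_l; assumption.
  - intros y. destruct (excluded_middle_informative (y = x)) as [->|Hn]; [ring|].
    field. apply Hnz, Hn.
Qed.

End Wrt.

(** The factor of the composite is a product of the two factors. Nothing is divided, so points [y]
    with [g y = g x] need no separate treatment. *)
Lemma is_derive_wrt_comp {X : UniformSpace} (iota : X -> C) (f : C -> C) (g : X -> C) x l m :
  @continuous X Cu iota x ->
  @is_derive_wrt Cu (fun z => z) f (g x) l -> is_derive_wrt iota g x m ->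
  is_derive_wrt iota (fun y => f (g y)) x (l * m)%C.
Proof.
  intros Hi (q & Hq & Eq & E) Hg.
  pose proof (is_derive_wrt_continuous iota _ _ _ Hi Hg) as Cg.
  destruct Hg as (r & Hr & Er & F).
  exists (fun y => q (g y) * r y)%C. split; [|split].
  - apply continuous_Cmult; [|exact Hr]. apply (@continuous_comp X Cu Cu g q x Cg Hq).
  - rewrite Eq, Er; reflexivity.
  - intros y. rewrite (E (g y)). rewrite (F y) at 2. ring.
Qed.

Local Notation Cderive := (@is_derive_wrt Cu (fun z => z)).
Local Notation Pderive := (@is_derive_wrt R_UniformSpace RtoC).

Lemma continuous_Cid (z : C) : @continuous Cu Cu (fun z => z) z.
Proof. apply continuous_id. Qed.

Lemma continuous_RtoC (t : R) : @continuous R_UniformSpace Cu RtoC t.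
Proof.
  apply continuous_Cu_eps. intros eps He. exists (mkposreal eps He). intros y Hy.
  change (Rabs (y - t) < eps) in Hy. rewrite <- RtoC_minus, Cmod_R. exact Hy.
Qed.

Lemma is_derive_iff_Cderive (f : C -> C) (z l : C) :
  @is_derive C_AbsRing C_NormedModule f z l <-> Cderive f z l.
Proof.
  split.
  - intros [_ H]. apply is_derive_wrt_of_eps; [intros y E; exact E|].
    intros eps He.
    generalize (H z (fun P HP => HP) (mkposreal eps He)). apply filter_imp. intros y Hy.
    change (Cmod (f y - f z - (y - z) * l) <= eps * Cmod (y - z)) in Hy.
    replace (l * (y - z))%C with ((y - z) * l)%C by ring. exact Hy.
  - intros H. split; [apply is_linear_scal_l|].
    intros x Hx. apply (is_filter_lim_locally_unique (V:=AbsRing_NormedModule C_AbsRing)) in Hx.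
  rewrite <- Hx. intros eps.
    generalize (@is_derive_wrt_eps Cu (fun z => z) f z l (continuous_Cid z) H eps (cond_pos eps)).
    apply filter_imp. intros y Hy.
    change (Cmod (f y - f z - (y - z) * l) <= eps * Cmod (y - z)).
    replace ((y - z) * l)%C with (l * (y - z))%C by ring. exact Hy.
Qed.

Lemma Pderive_is_derive (f : R -> C) (t : R) (l : C) :
  Pderive f t l -> @is_derive R_AbsRing C_R_NormedModule f t l.
Proof.
  intros H. split; [apply is_linear_scal_l|].
  intros x Hx. apply (is_filter_lim_locally_unique (V:=AbsRing_NormedModule R_AbsRing)) in Hx.
  rewrite <- Hx. intros eps.
  generalize (@is_derive_wrt_eps R_UniformSpace RtoC f t l (continuous_RtoC t) H eps
                (cond_pos eps)).
  apply filter_imp. intros y Hy.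
  rewrite <- RtoC_minus, Cmod_R in Hy.
  apply (Rle_trans _ (Cmod (f y - f t - l * RtoC (y - t)))); [|exact Hy].
  apply Req_le. rewrite Cmod_norm. apply (f_equal (@norm R_AbsRing C_R_NormedModule)).
  apply injective_projections; cbn; unfold mult; cbn; ring.
Qed.

(** Balls of [Cu] are discs for [Cmod], those of the product structure are squares; a disc lies in
    the square of the same radius. Derivatives live in the first structure and integrals over real
    intervals in the second. *)
Lemma continuous_Cu_CR (f : R -> C) (t : R) :
  @continuous R_UniformSpace Cu f t -> @continuous R_UniformSpace C_R_NormedModule f t.
Proof.
  intros H P HP. apply H. destruct HP as [eps He]. exists eps. intros y Hy. apply He.
  apply C_NormedModule_mixin_compat1. exact Hy.
Qed.

Definition cis (t : R) : C := (cos t, sin t).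

Lemma Cmod_cis (t : R) : Cmod (cis t) = 1.
Proof.
  unfold Cmod, cis; simpl fst; simpl snd.
  replace (cos t ^ 2 + sin t ^ 2) with 1; [apply sqrt_1|].
  pose proof (sin2_cos2 t) as H. unfold Rsqr in H. lra.
Qed.

Lemma cis_plus (s t : R) : (cis s * cis t)%C = cis (s + t).
Proof.
  unfold cis. rewrite cos_plus, sin_plus. apply injective_projections; simpl; ring.
Qed.

Lemma polar_cis (r t : R) : polar r t = (RtoC r * cis t)%C.
Proof. apply injective_projections; unfold polar; simpl; ring. Qed.

Lemma Pderive_pair (f g : R -> R) (t a b : R) :
  is_derive f t a -> is_derive g t b -> Pderive (fun s => (f s, g s)) t (a, b).
Proof.
  intros Hf Hg. apply is_derive_wrt_of_eps.
  { intros y E. injection E. auto. }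
  intros eps He. destruct Hf as [_ Hf], Hg as [_ Hg].
  assert (He2 : 0 < eps / 2) by lra.
  generalize (filter_and _ _ (Hf t (fun P HP => HP) (mkposreal _ He2))
                (Hg t (fun P HP => HP) (mkposreal _ He2))).
  apply filter_imp. intros y [H1 H2].
  change (Rabs (f y - f t - (y - t) * a) <= eps / 2 * Rabs (y - t)) in H1.
  change (Rabs (g y - g t - (y - t) * b) <= eps / 2 * Rabs (y - t)) in H2.
  rewrite <- RtoC_minus, Cmod_R.
  eapply Rle_trans; [apply Cmod_le_abs|]. simpl.
  replace (f y + - f t + - (a * (y - t) - b * 0)) with (f y - f t - (y - t) * a) by ring.
  replace (g y + - g t + - (a * 0 + b * (y - t))) with (g y - g t - (y - t) * b) by ring.
  lra.
Qed.

Lemma Pderive_cis (c t : R) : Pderive (fun s => cis (c * s)) t (Ci * RtoC c * cis (c * t))%C.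
Proof.
  replace (Ci * RtoC c * cis (c * t))%C with (- c * sin (c * t), c * cos (c * t)).
  2: { unfold cis. apply injective_projections; simpl; ring. }
  apply Pderive_pair; auto_derive; auto; ring.
Qed.

Lemma continuous_cis (c t : R) : @continuous R_UniformSpace Cu (fun s => cis (c * s)) t.
Proof.
  exact (is_derive_wrt_continuous RtoC _ _ _ (continuous_RtoC t) (Pderive_cis c t)).
Qed.

(** * Integrals along segments *)

Local Notation is_CRInt := (@is_RInt C_R_NormedModule).
Local Notation CRInt := (@RInt C_R_CompleteNormedModule).

Lemma is_CRInt_continuous (f : R -> C) (a b : R) : a <= b ->
  (forall t, a <= t <= b -> @continuous R_UniformSpace Cu f t) -> is_CRInt f a b (CRInt f a b).
Proof.
  intros Hab H. apply (@RInt_correct C_R_CompleteNormedModule).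
  apply (@ex_RInt_continuous C_R_CompleteNormedModule). intros t Ht.
  rewrite Rmin_left, Rmax_right in Ht by assumption. apply continuous_Cu_CR, H, Ht.
Qed.

Lemma is_CRInt_Pderive (f df : R -> C) (a b : R) : a <= b ->
  (forall t, a <= t <= b -> Pderive f t (df t)) ->
  (forall t, a <= t <= b -> @continuous R_UniformSpace Cu df t) ->
  is_CRInt df a b (f b - f a)%C.
Proof.
  intros Hab H1 H2. apply (@is_RInt_derive C_R_CompleteNormedModule f df a b);
    rewrite Rmin_left, Rmax_right by assumption; intros t Ht.
  - apply Pderive_is_derive, H1, Ht.
  - apply continuous_Cu_CR, H2, Ht.
Qed.

(** Multiplication by a complex constant mixes the coordinates, so real and imaginary parts are
    integrated separately and recombined. *)
Lemma is_CRInt_scal (c : C) (f : R -> C) (a b : R) (l : C) :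
  is_CRInt f a b l -> is_CRInt (fun t => c * f t)%C a b (c * l)%C.
Proof.
  intros H.
  pose proof (is_RInt_fct_extend_fst f a b l H) as H1.
  pose proof (is_RInt_fct_extend_snd f a b l H) as H2.
  destruct c as [x y].
  apply (@is_RInt_fct_extend_pair R_NormedModule R_NormedModule).
  - exact (is_RInt_minus _ _ a b _ _ (is_RInt_scal _ a b x _ H1) (is_RInt_scal _ a b y _ H2)).
  - exact (is_RInt_plus _ _ a b _ _ (is_RInt_scal _ a b x _ H2) (is_RInt_scal _ a b y _ H1)).
Qed.

Lemma is_CRInt_minus (f g : R -> C) (a b : R) (l m : C) :
  is_CRInt f a b l -> is_CRInt g a b m -> is_CRInt (fun t => f t - g t)%C a b (l - m)%C.
Proof. exact (@is_RInt_minus C_R_NormedModule f g a b l m). Qed.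

Lemma is_CRInt_const (c : C) (a b : R) : is_CRInt (fun _ => c) a b (RtoC (b - a) * c)%C.
Proof.
  replace (RtoC (b - a) * c)%C with (@scal R_AbsRing C_R_NormedModule (b - a) c).
  - apply is_RInt_const.
  - apply injective_projections; cbn; unfold mult; cbn; ring.
Qed.

Lemma is_CRInt_ext (f g : R -> C) (a b : R) (l : C) : a <= b ->
  (forall t, a <= t <= b -> f t = g t) -> is_CRInt f a b l -> is_CRInt g a b l.
Proof.
  intros Hab E. apply is_RInt_ext. intros t Ht.
  rewrite Rmin_left, Rmax_right in Ht by assumption. apply E. lra.
Qed.

Lemma CRInt_bound (f : R -> C) (a b M : R) (l : C) : a <= b ->
  (forall t, a <= t <= b -> Cmod (f t) <= M) -> is_CRInt f a b l -> Cmod l <= (b - a) * M.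
Proof.
  intros Hab H Hf. rewrite Cmod_norm.
  apply (@norm_RInt_le_const C_R_NormedModule f a b l M Hab); [|exact Hf].
  intros t Ht. apply (Rle_trans _ (Cmod (f t))); [|apply H, Ht].
  apply Req_le; symmetry; apply Cmod_norm.
Qed.

Lemma CRInt_le (f : R -> C) (g : R -> R) (a b : R) (l : C) (m : R) : a <= b ->
  (forall t, a <= t <= b -> Cmod (f t) <= g t) -> is_CRInt f a b l -> is_RInt g a b m ->
  Cmod l <= m.
Proof.
  intros Hab H Hf Hg. rewrite Cmod_norm.
  apply (@norm_RInt_le C_R_NormedModule f g a b l m Hab); [|exact Hf|exact Hg].
  intros t Ht. apply (Rle_trans _ (Cmod (f t))); [|apply H, Ht].
  apply Req_le; symmetry; apply Cmod_norm.
Qed.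

Lemma is_CRInt_unique (f : R -> C) (a b : R) (l : C) : is_CRInt f a b l -> CRInt f a b = l.
Proof. exact (@is_RInt_unique C_R_CompleteNormedModule f a b l). Qed.

Lemma is_CRInt_functional (f : R -> C) (a b : R) (l m : C) :
  is_CRInt f a b l -> is_CRInt f a b m -> l = m.
Proof.
  intros H1 H2. rewrite <- (is_CRInt_unique _ _ _ _ H1). apply is_CRInt_unique, H2.
Qed.

Definition segpt (a b : C) (t : R) : C := (a + RtoC t * (b - a))%C.

Definition seg_int (f : C -> C) (a b : C) : C :=
  CRInt (fun t => f (segpt a b t) * (b - a))%C 0 1.

Definition seg_continuous (f : C -> C) (a b : C) : Prop :=
  forall t, 0 <= t <= 1 -> @continuous R_UniformSpace Cu (fun s => f (segpt a b s)) t.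

Lemma Pderive_segpt (a b : C) (t : R) : Pderive (segpt a b) t (b - a)%C.
Proof.
  exists (fun _ => b - a)%C. split; [apply continuous_Cconst|]. split; [reflexivity|].
  intros y. unfold segpt. ring.
Qed.

Lemma continuous_segpt (a b : C) (t : R) : @continuous R_UniformSpace Cu (segpt a b) t.
Proof.
  exact (is_derive_wrt_continuous RtoC _ _ _ (continuous_RtoC t) (Pderive_segpt a b t)).
Qed.

Lemma segpt_convex (a b c : C) (t : R) : 0 <= t <= 1 ->
  Cmod (segpt a b t - c) <= Rmax (Cmod (a - c)) (Cmod (b - c)).
Proof.
  intros Ht. unfold segpt.
  replace (a + RtoC t * (b - a) - c)%C with (RtoC (1 - t) * (a - c) + RtoC t * (b - c))%C
    by (rewrite RtoC_minus; ring).
  eapply Rle_trans; [apply Cmod_triangle|].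
  rewrite !Cmod_mult, !Cmod_R, !Rabs_right by lra.
  pose proof (Rmax_l (Cmod (a - c)) (Cmod (b - c))).
  pose proof (Rmax_r (Cmod (a - c)) (Cmod (b - c))). nra.
Qed.

Lemma segpt_disc (a b : C) (r t : R) : 0 <= t <= 1 ->
  Cmod a < r -> Cmod b < r -> Cmod (segpt a b t) < r.
Proof.
  intros Ht Ha Hb. pose proof (segpt_convex a b 0 t Ht) as H.
  replace (segpt a b t - 0)%C with (segpt a b t) in H by ring.
  replace (a - 0)%C with a in H by ring. replace (b - 0)%C with b in H by ring.
  apply (Rle_lt_trans _ _ _ H), Rmax_lub_lt; assumption.
Qed.

Lemma is_CRInt_seg (f : C -> C) (a b : C) : seg_continuous f a b ->
  is_CRInt (fun t => f (segpt a b t) * (b - a))%C 0 1 (seg_int f a b).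
Proof.
  intros H. apply is_CRInt_continuous; [lra|]. intros t Ht.
  apply continuous_Cmult; [apply H, Ht|apply continuous_Cconst].
Qed.

Lemma seg_int_primitive (F f : C -> C) (a b : C) :
  (forall t, 0 <= t <= 1 -> Cderive F (segpt a b t) (f (segpt a b t))) ->
  seg_continuous f a b -> seg_int f a b = (F b - F a)%C.
Proof.
  intros HF Hc. apply is_CRInt_unique.
  replace (F b - F a)%C with (F (segpt a b 1) - F (segpt a b 0))%C.
  2: { unfold segpt. f_equal; [f_equal; ring|f_equal; f_equal; ring]. }
  apply (is_CRInt_Pderive (fun t => F (segpt a b t))); [lra| |].
  - intros t Ht.
    apply is_derive_wrt_comp; [apply continuous_RtoC|apply HF, Ht|apply Pderive_segpt].
  - intros t Ht. apply continuous_Cmult; [apply Hc, Ht|apply continuous_Cconst].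
Qed.

(* [c w + l (w^2/2 - x w)] is a primitive of the affine approximation [c + l (w - x)]. *)
Lemma seg_int_affine_approx (f : C -> C) (a b c l x : C) (M : R) :
  let P w := (c * w + l * (w * w / 2 - x * w))%C in
  seg_continuous f a b ->
  (forall t, 0 <= t <= 1 -> Cmod (f (segpt a b t) - (c + l * (segpt a b t - x))) <= M) ->
  Cmod (seg_int f a b - (P b - P a)) <= M * Cmod (b - a).
Proof.
  intros P Hc HM.
  set (A := fun w => (c + l * (w - x))%C).
  assert (HA : seg_continuous A a b).
  { intros t Ht. apply continuous_Cplus; [apply continuous_Cconst|].
    apply continuous_Cmult; [apply continuous_Cconst|].
    apply continuous_Cminus; [apply continuous_segpt|apply continuous_Cconst]. }
  assert (HP : forall w, Cderive P w (A w)).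
  { intros w. exists (fun y => c + l * ((y + w) / 2 - x))%C. split; [|split].
    (* The factor [c + l * ((y + w) / 2 - x)] is [(P y - P w) / (y - w)] with the division carried
       out. *)
    - apply (@continuous_Cplus Cu); [apply (@continuous_Cconst Cu)|].
      apply continuous_Cmult; [apply continuous_Cconst|].
      apply continuous_Cminus; [|apply continuous_Cconst].
      apply continuous_Cmult; [|apply continuous_Cconst].
      apply continuous_Cplus; [exact (continuous_Cid w)|apply continuous_Cconst].
    - unfold A. field. 
    - intros y. unfold P. field. }
  rewrite <- (seg_int_primitive P A a b) by (auto; intros; apply HP).
  pose proof (is_CRInt_minus _ _ _ _ _ _ (is_CRInt_seg f a b Hc) (is_CRInt_seg A a b HA)) as HI.
  replace (M * Cmod (b - a)) with ((1 - 0) * (M * Cmod (b - a))) by ring.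
  apply (CRInt_bound _ 0 1 _ _ Rle_0_1) with (2 := HI).
  intros t Ht.
  replace (f (segpt a b t) * (b - a) - A (segpt a b t) * (b - a))%C
    with ((f (segpt a b t) - A (segpt a b t)) * (b - a))%C by ring.
  rewrite Cmod_mult. apply Rmult_le_compat_r; [apply Cmod_ge_0|apply HM, Ht].
Qed.

(** The substitution [t -> 1 - t], in the affine form used by [is_RInt_comp_lin]. *)
Lemma seg_int_rev (f : C -> C) (a b : C) : seg_continuous f a b ->
  seg_int f b a = (- seg_int f a b)%C.
Proof.
  intros Hc. apply is_CRInt_unique.
  pose proof (is_CRInt_seg f a b Hc) as H. apply is_RInt_swap in H.
  assert (H' : is_CRInt (fun t => f (segpt a b t) * (b - a))%C (-1 * 0 + 1) (-1 * 1 + 1)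
    (- seg_int f a b)%C).
  { replace (-1 * 0 + 1) with 1 by ring. replace (-1 * 1 + 1) with 0 by ring. exact H. }
  apply is_RInt_comp_lin in H'. revert H'. apply is_CRInt_ext; [lra|].
  intros t Ht. replace (segpt a b (-1 * t + 1)) with (segpt b a t).
  - apply injective_projections; cbn; unfold mult; cbn; ring.
  - unfold segpt. rewrite RtoC_plus, RtoC_mult. replace (RtoC (-1)) with (- (1))%C; [ring|].
    apply injective_projections; simpl; ring.
Qed.

Definition mid (a b : C) : C := ((a + b) / 2)%C.

Lemma mid_segpt (a b : C) : mid a b = segpt a b (/ 2).
Proof. unfold mid, segpt. rewrite RtoC_inv by lra. field. Qed.

Lemma seg_int_mid (f : C -> C) (a b : C) : seg_continuous f a b ->
  (seg_int f a (mid a b) + seg_int f (mid a b) b)%C = seg_int f a b.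
Proof.
  intros Hc. pose proof (is_CRInt_seg f a b Hc) as H.
  set (phi := fun t => (f (segpt a b t) * (b - a))%C) in *.
  assert (Hphi : forall t, 0 <= t <= 1 -> @continuous R_UniformSpace Cu phi t).
  { intros t Ht. apply continuous_Cmult; [apply Hc, Ht|apply continuous_Cconst]. }
  assert (H1 : is_CRInt phi 0 (/2) (CRInt phi 0 (/2))).
  { apply is_CRInt_continuous; [lra|]. intros t Ht; apply Hphi; lra. }
  assert (H2 : is_CRInt phi (/2) 1 (CRInt phi (/2) 1)).
  { apply is_CRInt_continuous; [lra|]. intros t Ht; apply Hphi; lra. }
  (* One affine reparametrisation serves both halves: [v = 0] for the first and [v = / 2] for the
     second. *)
  assert (HE : forall v t, f (segpt a b (/ 2 * t + v))
    = f (segpt (segpt a b v) (segpt a b (v + / 2)) t)).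
  { intros v t. f_equal. unfold segpt. rewrite !RtoC_plus, RtoC_mult, RtoC_inv by lra. field. }
  rewrite (is_CRInt_functional _ _ _ _ _ H (is_RInt_Chasles _ _ _ _ _ _ H1 H2)).
  apply (f_equal2 Cplus).
  - apply is_CRInt_unique.
    assert (H' : is_CRInt phi (/ 2 * 0 + 0) (/ 2 * 1 + 0) (CRInt phi 0 (/ 2))).
    { replace (/ 2 * 0 + 0) with 0 by ring. replace (/ 2 * 1 + 0) with (/ 2) by ring. exact H1. }
    apply is_RInt_comp_lin in H'. revert H'. apply is_CRInt_ext; [lra|].
    intros t Ht. unfold phi. rewrite HE.
    replace (segpt a b 0) with a by (unfold segpt; ring).
    rewrite Rplus_0_l, <- mid_segpt.
    replace (mid a b - a)%C with (RtoC (/ 2) * (b - a))%C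
      by (unfold mid; rewrite RtoC_inv by lra; field).
    apply injective_projections; cbn; unfold mult; cbn; ring.
  - apply is_CRInt_unique.
    assert (H' : is_CRInt phi (/ 2 * 0 + / 2) (/ 2 * 1 + / 2) (CRInt phi (/ 2) 1)).
    { replace (/ 2 * 0 + / 2) with (/ 2) by ring. replace (/ 2 * 1 + / 2) with 1 by field.
      exact H2. }
    apply is_RInt_comp_lin in H'. revert H'. apply is_CRInt_ext; [lra|].
    intros t Ht. unfold phi. rewrite HE.
    replace (segpt a b (/ 2 + / 2)) with b
      by (replace (/ 2 + / 2) with 1 by field; unfold segpt; ring).
    rewrite <- mid_segpt.
    replace (b - mid a b)%C with (RtoC (/ 2) * (b - a))%C
      by (unfold mid; rewrite RtoC_inv by lra; field).
    apply injective_projections; cbn; unfold mult; cbn; ring.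
Qed.

(** * Goursat's theorem and primitives *)

(** The tail of the geometric series from [n] on is [2 * s * (/ 2) ^ n]. Subtracting it from [u n]
    gives an increasing sequence, adding it a decreasing one; the supremum of the lower sequence
    lies between them. *)
Lemma geometric_Cauchy_limit (u : nat -> R) (s : R) :
  (forall n, Rabs (u (S n) - u n) <= s * (/ 2) ^ n) ->
  exists l, forall n, Rabs (u n - l) <= 2 * s * (/ 2) ^ n.
Proof.
  intros H.
  set (v := fun n => u n - 2 * s * (/ 2) ^ n). set (w := fun n => u n + 2 * s * (/ 2) ^ n).
  assert (Hs : 0 <= s).
  { specialize (H 0%nat). simpl in H. pose proof (Rabs_pos (u 1%nat - u 0%nat)). lra. }
  assert (Hmon : forall n k, v n <= v (n + k)%nat /\ w (n + k)%nat <= w n).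
  { intros n k. induction k as [|k [I1 I2]]; [rewrite Nat.add_0_r; lra|].
    rewrite Nat.add_succ_r. specialize (H (n + k)%nat). apply Rabs_le_between in H.
    unfold v, w in *. simpl. split; lra. }
  assert (Hpow : forall n, 0 < (/ 2) ^ n) by (intros; apply pow_lt; lra).
  assert (Hvw : forall n m, v n <= w m).
  { intros n m. destruct (Hmon n m) as [I1 _], (Hmon m n) as [_ I2].
    rewrite Nat.add_comm in I2. specialize (Hpow (n + m)%nat).
    assert (v (n + m)%nat <= w (n + m)%nat) by (unfold v, w; nra). lra. }
  destruct (completeness (fun x => exists n, x = v n)) as [l [Hl1 Hl2]].
  - exists (w 0%nat). intros x [n ->]. apply Hvw.
  - exists (v 0%nat), 0%nat. reflexivity.
  - exists l. intros n. apply Rabs_le_between.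
    assert (v n <= l) by (apply Hl1; exists n; reflexivity).
    assert (l <= w n) by (apply Hl2; intros x [m ->]; apply Hvw).
    unfold v, w in *. lra.
Qed.

Lemma pow_half_small (s d : R) : 0 <= s -> 0 < d -> exists n, s * (/ 2) ^ n < d.
Proof.
  intros Hs Hd.
  destruct (pow_lt_1_zero (/ 2) ltac:(rewrite Rabs_right; lra) (d / (s + 1))) as [N HN].
  { apply Rdiv_lt_0_compat; lra. }
  exists N. specialize (HN N (le_n N)).
  assert (Hp : 0 < (/ 2) ^ N) by (apply pow_lt; lra).
  rewrite Rabs_right in HN by lra. apply Rlt_div_r in HN; [nra|lra].
Qed.

(** Size is measured by the perimeter because it halves exactly under bisection and bounds both the
    sides and the length of the contour. *)
Definition perimeter (a b c : C) : R := Cmod (b - a) + Cmod (c - b) + Cmod (a - c).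

Lemma perimeter_ge_0 (a b c : C) : 0 <= perimeter a b c.
Proof.
  unfold perimeter.
  pose proof (Cmod_ge_0 (b - a)); pose proof (Cmod_ge_0 (c - b)); pose proof (Cmod_ge_0 (a - c)).
  lra.
Qed.

Lemma Cmod_half (u v : C) : u = (v / 2)%C -> Cmod u = Cmod v / 2.
Proof.
  intros ->. rewrite Cmod_div by (intros E; injection E; lra). rewrite Cmod_R, Rabs_right by lra.
  reflexivity.
Qed.

Lemma Cmod_mid_le (a b : C) (m : R) : Cmod a <= m -> Cmod b <= m -> Cmod (mid a b) <= m.
Proof.
  intros Ha Hb. unfold mid. rewrite (Cmod_half _ (a + b)%C) by reflexivity.
  pose proof (Cmod_triangle a b). lra.
Qed.

(** Every side of a subtriangle is half of a side of the original one. The vertices are listed so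
    that all four triangles inherit the orientation of [a b c], which makes the inner edges cancel
    in [tri_int_split]. *)
Lemma perimeter_subtriangles (a b c : C) :
  perimeter a (mid a b) (mid c a) = perimeter a b c / 2 /\
  perimeter (mid a b) b (mid b c) = perimeter a b c / 2 /\
  perimeter (mid c a) (mid b c) c = perimeter a b c / 2 /\
  perimeter (mid a b) (mid b c) (mid c a) = perimeter a b c / 2.
Proof.
  unfold perimeter, mid.
  rewrite (Cmod_half ((a + b) / 2 - a) (b - a))%C by field.
  rewrite (Cmod_half ((c + a) / 2 - (a + b) / 2) (c - b))%C by field.
  rewrite (Cmod_half (a - (c + a) / 2) (a - c))%C by field.
  rewrite (Cmod_half (b - (a + b) / 2) (b - a))%C by field.
  rewrite (Cmod_half ((b + c) / 2 - b) (c - b))%C by field.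
  rewrite (Cmod_half ((a + b) / 2 - (b + c) / 2) (a - c))%C by field.
  rewrite (Cmod_half ((b + c) / 2 - (c + a) / 2) (b - a))%C by field.
  rewrite (Cmod_half (c - (b + c) / 2) (c - b))%C by field.
  rewrite (Cmod_half ((c + a) / 2 - c) (a - c))%C by field.
  rewrite (Cmod_half ((b + c) / 2 - (a + b) / 2) (c - a))%C by field.
  rewrite (Cmod_half ((c + a) / 2 - (b + c) / 2) (a - b))%C by field.
  rewrite (Cmod_half ((a + b) / 2 - (c + a) / 2) (b - c))%C by field.
  rewrite (Cmod_minus_sym c a), (Cmod_minus_sym a b), (Cmod_minus_sym b c). lra.
Qed.

(** If [P] fails for a triangle, it fails for one of the four quarters, and so on forever; the
    quarters shrink to a point [x] of the disc, where the local hypothesis is contradicted. That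
    hypothesis locates [x] only through its distance to the first vertex, so it need not be known
    that [x] lies in the triangles. *)
Lemma triangle_bisection (P : C -> C -> C -> Prop) (r : R) :
  (forall a b c, Cmod a < r -> Cmod b < r -> Cmod c < r ->
    P a (mid a b) (mid c a) -> P (mid a b) b (mid b c) -> P (mid c a) (mid b c) c ->
    P (mid a b) (mid b c) (mid c a) -> P a b c) ->
  (forall x, Cmod x < r -> exists d, 0 < d /\ forall a b c,
    Cmod (a - x) < d -> Cmod (b - x) < d -> Cmod (c - x) < d ->
    Cmod (a - x) <= 4 * perimeter a b c -> P a b c) ->
  forall a b c, Cmod a < r -> Cmod b < r -> Cmod c < r -> P a b c.
Proof.
  intros Hsub Hloc a b c Ha Hb Hc. apply NNPP. intros HN.
  (* All vertices stay in the closed disc of radius [m], which is closed under midpoints; the gap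
     between [m] and [r] keeps the limit point inside the open disc. *)
  set (m := Rmax (Cmod a) (Rmax (Cmod b) (Cmod c))).
  assert (Hm : m < r) by (repeat apply Rmax_lub_lt; assumption).
  set (bad := fun T : C * C * C => let '(x, y, z) := T in
    ~ P x y z /\ Cmod x <= m /\ Cmod y <= m /\ Cmod z <= m).
  set (per := fun T : C * C * C => let '(x, y, z) := T in perimeter x y z).
  set (vtx := fun T : C * C * C => let '(x, y, z) := T in x).
  (* Stated as an implication from [bad T], so that every [T] has a successor and [epsilon] yields a
     total function [next]. *)
  set (Q := fun T T' : C * C * C => bad T ->
    bad T' /\ per T' = per T / 2 /\ Cmod (vtx T' - vtx T) <= per T).
  assert (Hstep : forall T, exists T', Q T T').
  { intros [[x y] z]. destruct (classic (bad (x, y, z))) as [HB|HB].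
    2: { exists (x, y, z). intros HB'. contradiction. }
    destruct HB as (HP & Hx & Hy & Hz).
    destruct (perimeter_subtriangles x y z) as (S1 & S2 & S3 & S4).
    assert (M1 := Cmod_mid_le _ _ _ Hx Hy). assert (M2 := Cmod_mid_le _ _ _ Hy Hz).
    assert (M3 := Cmod_mid_le _ _ _ Hz Hx).
    pose proof (Cmod_ge_0 (y - x)) as G1. pose proof (Cmod_ge_0 (z - y)) as G2.
    pose proof (Cmod_ge_0 (x - z)) as G3.
    assert (D1 : Cmod (mid x y - x) = Cmod (y - x) / 2)
      by (apply Cmod_half; unfold mid; field).
    assert (D3 : Cmod (mid z x - x) = Cmod (x - z) / 2).
    { rewrite (Cmod_minus_sym x z). apply Cmod_half; unfold mid; field. }
    destruct (classic (P x (mid x y) (mid z x))) as [P1|P1].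
    2: { exists (x, mid x y, mid z x). intros _. unfold bad, per, vtx.
         repeat split; try assumption.
         replace (x - x)%C with (RtoC 0) by ring. rewrite Cmod_0. apply perimeter_ge_0. }
    destruct (classic (P (mid x y) y (mid y z))) as [P2|P2].
    2: { exists (mid x y, y, mid y z). intros _. unfold bad, per, vtx.
         repeat split; try assumption. unfold perimeter. lra. }
    destruct (classic (P (mid z x) (mid y z) z)) as [P3|P3].
    2: { exists (mid z x, mid y z, z). intros _. unfold bad, per, vtx.
         repeat split; try assumption. unfold perimeter. lra. }
    exists (mid x y, mid y z, mid z x). intros _. unfold bad, per, vtx.
    repeat split; try assumption; [|unfold perimeter; lra].
    intros P4. apply HP, Hsub; try assumption; lra. }
  set (next := fun T => epsilon (inhabits T) (Q T)).
  assert (Hnext : forall T, Q T (next T)) by (intros T; apply epsilon_spec, Hstep).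
  set (T := fun n => Nat.iter n next (a, b, c)).
  assert (Hbad : forall n, bad (T n)).
  { induction n as [|n IH]; [|apply Hnext, IH].
    unfold T, bad; simpl. repeat split; [exact HN| | |]; unfold m.
    - apply Rmax_l.
    - eapply Rle_trans; [apply Rmax_l|apply Rmax_r].
    - eapply Rle_trans; [apply Rmax_r|apply Rmax_r]. }
  set (s := perimeter a b c).
  assert (Hs : 0 <= s) by apply perimeter_ge_0.
  assert (Hper : forall n, per (T n) = s * (/ 2) ^ n).
  { induction n as [|n IH]; [unfold T; simpl; unfold s; ring|].
    destruct (Hnext (T n) (Hbad n)) as (_ & E & _).
    change (T (S n)) with (next (T n)). rewrite E, IH. simpl. field. }
  assert (Hd : forall n, Cmod (vtx (T (S n)) - vtx (T n)) <= s * (/ 2) ^ n).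
  { intros n. rewrite <- Hper. apply (Hnext (T n) (Hbad n)). }
  destruct (geometric_Cauchy_limit (fun n => fst (vtx (T n))) s) as [x Hx].
  { intros n. eapply Rle_trans; [|apply Hd].
    exact (Rle_trans _ _ _ (Rmax_l _ _) (Rmax_Cmod (vtx (T (S n)) - vtx (T n))%C)). }
  destruct (geometric_Cauchy_limit (fun n => snd (vtx (T n))) s) as [y Hy].
  { intros n. eapply Rle_trans; [|apply Hd].
    exact (Rle_trans _ _ _ (Rmax_r _ _) (Rmax_Cmod (vtx (T (S n)) - vtx (T n))%C)). }
  (* Each coordinate of the limit is within [2 * per (T n)] of the first vertex, and the modulus is
     at most the sum of the two. *)
  assert (Hlim : forall n, Cmod (vtx (T n) - (x, y)) <= 4 * per (T n)).
  { intros n. eapply Rle_trans; [apply Cmod_le_abs|].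
    specialize (Hx n). specialize (Hy n). rewrite Hper.
    unfold Rminus in Hx, Hy. simpl. lra. }
  assert (Hr : Cmod (x, y) < r).
  { destruct (pow_half_small (4 * s) (r - m)) as [n Hn]; [lra|lra|].
    specialize (Hlim n). rewrite Hper in Hlim. specialize (Hbad n).
    destruct (T n) as [[u v] w]. destruct Hbad as (_ & Hu & _). unfold vtx in Hlim.
    pose proof (Cmod_minus_le (x, y) u) as H. rewrite Cmod_minus_sym in H. lra. }
  destruct (Hloc (x, y) Hr) as (d & Hd0 & HP).
  (* The first vertex is within 4 perimeters of the limit, hence the other two are within 5. *)
  destruct (pow_half_small (5 * s) d) as [n Hn]; [lra|assumption|].
  specialize (Hlim n). specialize (Hper n). specialize (Hbad n).
  destruct (T n) as [[u v] w]. destruct Hbad as (HB & _). unfold vtx, per in *.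
  assert (Hpos : 0 <= s * (/ 2) ^ n) by (apply Rmult_le_pos; [assumption|apply pow_le; lra]).
  pose proof (Cmod_ge_0 (v - u)) as G1. pose proof (Cmod_ge_0 (w - v)) as G2.
  pose proof (Cmod_ge_0 (u - w)) as G3.
  assert (Hsz := Hper). unfold perimeter in Hsz.
  apply HB, HP; [lra| | |assumption].
  - pose proof (Cmod_minus_triangle v u (x, y)). lra.
  - pose proof (Cmod_minus_triangle w u (x, y)). rewrite (Cmod_minus_sym w u) in *. lra.
Qed.

Definition tri_int (f : C -> C) (a b c : C) : C :=
  (seg_int f a b + seg_int f b c + seg_int f c a)%C.

Lemma analytic_iff (f : C -> C) :
  analytic f <-> forall z, Cmod z < 1 -> Cderive f z (cderiv f z).
Proof.
  split; intros H z Hz.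
  - destruct (H z Hz) as [l Hl]. unfold cderiv. rewrite (is_C_derive_unique _ _ _ Hl).
    apply is_derive_iff_Cderive, Hl.
  - exists (cderiv f z). apply is_derive_iff_Cderive, H, Hz.
Qed.

Lemma analytic_continuous_path {X : UniformSpace} (f : C -> C) (g : X -> C) (x : X) :
  analytic f -> Cmod (g x) < 1 -> @continuous X Cu g x -> @continuous X Cu (fun y => f (g y)) x.
Proof.
  intros Hf Hg Cg. apply (@continuous_comp X Cu Cu); [exact Cg|].
  apply (@is_derive_wrt_continuous Cu (fun z => z) f _ _ (continuous_Cid _)
           (proj1 (analytic_iff f) Hf _ Hg)).
Qed.

Lemma analytic_seg_continuous (f : C -> C) (a b : C) :
  analytic f -> Cmod a < 1 -> Cmod b < 1 -> seg_continuous f a b.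
Proof.
  intros Hf Ha Hb t Ht. apply analytic_continuous_path; [exact Hf| |apply continuous_segpt].
  apply segpt_disc; assumption.
Qed.

(** Each inner edge is traversed once in each direction, and the halves of the outer edges recombine
    by [seg_int_mid]. *)
Lemma tri_int_split (f : C -> C) (a b c : C) :
  analytic f -> Cmod a < 1 -> Cmod b < 1 -> Cmod c < 1 ->
  tri_int f a b c = (tri_int f a (mid a b) (mid c a) + tri_int f (mid a b) b (mid b c)
    + tri_int f (mid c a) (mid b c) c + tri_int f (mid a b) (mid b c) (mid c a))%C.
Proof.
  intros Hf Ha Hb Hc. unfold tri_int.
  assert (D : forall x y, Cmod x < 1 -> Cmod y < 1 -> Cmod (mid x y) < 1).
  { intros x y Hx Hy. rewrite mid_segpt. apply segpt_disc; [lra| |]; assumption. }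
  rewrite <- (seg_int_mid f a b), <- (seg_int_mid f b c), <- (seg_int_mid f c a)
    by (apply analytic_seg_continuous; auto).
  rewrite (seg_int_rev f (mid a b) (mid c a)), (seg_int_rev f (mid a b) (mid b c)),
    (seg_int_rev f (mid b c) (mid c a)) by (apply analytic_seg_continuous; auto).
  ring.
Qed.

(** The bound [eps * perimeter ^ 2] is invariant under bisection: four quarters contribute
    [eps * (perimeter / 2) ^ 2] each. Near a point of differentiability it holds because the affine
    approximation has a primitive and so integrates to zero around the triangle. *)
Lemma Goursat (f : C -> C) (a b c : C) :
  analytic f -> Cmod a < 1 -> Cmod b < 1 -> Cmod c < 1 -> tri_int f a b c = 0%C.
Proof.
  intros Hf Ha Hb Hc. apply Cmod_eq_0.
  assert (H : forall eps, 0 < eps -> Cmod (tri_int f a b c) <= eps * (perimeter a b c) ^ 2).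
  { intros eps He. revert a b c Ha Hb Hc.
    apply (triangle_bisection
             (fun a b c => Cmod (tri_int f a b c) <= eps * (perimeter a b c) ^ 2) 1).
    - intros a b c Ha Hb Hc H1 H2 H3 H4. rewrite (tri_int_split f a b c) by assumption.
      destruct (perimeter_subtriangles a b c) as (E1 & E2 & E3 & E4).
      rewrite E1 in H1. rewrite E2 in H2. rewrite E3 in H3. rewrite E4 in H4.
      eapply Rle_trans; [apply Cmod_triangle|].
      eapply Rle_trans; [apply Rplus_le_compat_r, Cmod_triangle|].
      eapply Rle_trans; [apply Rplus_le_compat_r, Rplus_le_compat_r, Cmod_triangle|].
      lra.
    - intros x Hx. pose proof (proj1 (analytic_iff f) Hf x Hx) as Hd.
      (* All points of the triangle will be within [5 * S] of [x], so [eps / 5] makes the error on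
         the contour at most [eps * S]. *)
      destruct (@is_derive_wrt_eps Cu (fun z => z) f x _ (continuous_Cid x) Hd (eps / 5)
                  ltac:(lra)) as [d Hdl].
      exists (Rmin d (1 - Cmod x)).
      split; [apply Rmin_glb_lt; [apply cond_pos|lra]|].
      intros a b c Ha Hb Hc Hax.
      set (S := perimeter a b c) in *.
      pose proof (Cmod_ge_0 (b - a)) as G1. pose proof (Cmod_ge_0 (c - b)) as G2.
      pose proof (Cmod_ge_0 (a - c)) as G3.
      assert (HS : S = Cmod (b - a) + Cmod (c - b) + Cmod (a - c)) by reflexivity.
      assert (Hbx : Cmod (b - x) <= 5 * S) by (pose proof (Cmod_minus_triangle b a x); lra).
      assert (Hcx : Cmod (c - x) <= 5 * S).
      { pose proof (Cmod_minus_triangle c a x). rewrite (Cmod_minus_sym c a) in *. lra. }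
      assert (Hax' : Cmod (a - x) <= 5 * S) by lra.
      assert (Hdisc : forall w, Cmod (w - x) < Rmin d (1 - Cmod x) -> Cmod w < 1).
      { intros w Hw. pose proof (Cmod_minus_le w x).
        pose proof (Rmin_r d (1 - Cmod x)). lra. }
      set (P := fun w => (f x * w + cderiv f x * (w * w / 2 - x * w))%C).
      assert (Hseg : forall p q,
        Cmod (p - x) < Rmin d (1 - Cmod x) -> Cmod (q - x) < Rmin d (1 - Cmod x) ->
        Cmod (p - x) <= 5 * S -> Cmod (q - x) <= 5 * S ->
        Cmod (seg_int f p q - (P q - P p)) <= eps * S * Cmod (q - p)).
      { intros p q Hp Hq Hp5 Hq5.
        apply (seg_int_affine_approx f p q (f x) (cderiv f x) x).
        { apply analytic_seg_continuous; auto. }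
        intros t Ht. pose proof (segpt_convex p q x t Ht) as Hw.
        set (w := segpt p q t) in *.
        assert (Hw1 : Cmod (w - x) < d).
        { eapply Rle_lt_trans; [exact Hw|]. pose proof (Rmin_l d (1 - Cmod x)).
          apply Rmax_lub_lt; lra. }
        assert (Hw2 : Cmod (w - x) <= 5 * S).
        { eapply Rle_trans; [exact Hw|]. apply Rmax_lub; assumption. }
        specialize (Hdl w Hw1).
        replace (f w - (f x + cderiv f x * (w - x)))%C
          with (f w - f x - cderiv f x * (w - x))%C by ring.
        eapply Rle_trans; [exact Hdl|]. nra. }
      pose proof (Hseg a b Ha Hb Hax' Hbx) as I1. pose proof (Hseg b c Hb Hc Hbx Hcx) as I2.
      pose proof (Hseg c a Hc Ha Hcx Hax') as I3.
      (* The increments of [P] along the three sides sum to zero. *)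
      replace (tri_int f a b c) with ((seg_int f a b - (P b - P a)) + (seg_int f b c - (P c - P b))
        + (seg_int f c a - (P a - P c)))%C by (unfold tri_int; ring).
      eapply Rle_trans; [apply Cmod_triangle|].
      eapply Rle_trans; [apply Rplus_le_compat_r, Cmod_triangle|].
      rewrite HS at 1. simpl. nra. }
  pose proof (Cmod_ge_0 (tri_int f a b c)) as G.
  destruct (Req_dec (Cmod (tri_int f a b c)) 0) as [E|E]; [exact E|exfalso].
  set (S := (perimeter a b c) ^ 2) in *. set (v := Cmod (tri_int f a b c)) in *.
  assert (HS : 0 <= S) by apply pow2_ge_0.
  (* This [eps] makes the bound strictly smaller than [v]; the summand 1 covers degenerate triangles
     with [S = 0]. *)
  assert (Hq : 0 < v / (2 * (S + 1))) by (apply Rdiv_lt_0_compat; lra).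
  specialize (H _ Hq).
  assert (v / (2 * (S + 1)) * S < v); [|lra].
  replace v with (v / (2 * (S + 1)) * (2 * (S + 1))) at 2 by (field; lra).
  apply Rmult_lt_compat_l; lra.
Qed.

Lemma locally_disc (z : C) (r : R) : Cmod z < r -> @locally Cu z (fun w => Cmod w < r).
Proof.
  intros Hz. exists (mkposreal (r - Cmod z) ltac:(lra)). intros w Hw.
  change (Cmod (w - z) < r - Cmod z) in Hw. pose proof (Cmod_minus_le w z). lra.
Qed.

(** Goursat's theorem on the triangle [0, z, w] turns the increment into the integral over [[z, w]].
    Continuity of [f] at [z] compares it with [f z * (w - z)], by the affine estimate with slope
    0. *)
Lemma analytic_primitive (f : C -> C) (z : C) :
  analytic f -> Cmod z < 1 -> Cderive (seg_int f 0) z (f z).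
Proof.
  intros Hf Hz. apply is_derive_wrt_of_eps; [intros y E; exact E|].
  intros eps He.
  assert (H0 : Cmod 0 < 1) by (rewrite Cmod_0; lra).
  pose proof (analytic_continuous_path (X := Cu) f (fun w => w) z Hf Hz (continuous_Cid z)) as Hc.
  destruct (filter_and _ _ (locally_disc z 1 Hz)
              (proj1 (continuous_Cu_eps _ _) Hc eps He)) as [d Hd].
  exists d. intros w Hw. destruct (Hd w Hw) as [Hw1 _].
  assert (E : (seg_int f 0 w - seg_int f 0 z)%C = seg_int f z w).
  { pose proof (Goursat f 0 z w Hf H0 Hz Hw1) as G. unfold tri_int in G.
    rewrite (seg_int_rev f 0 w) in G by (apply analytic_seg_continuous; assumption).
    replace (seg_int f 0 w) with (seg_int f 0 z + seg_int f z w
      - (seg_int f 0 z + seg_int f z w + - seg_int f 0 w))%C by ring.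
    rewrite G. ring. }
  rewrite E.
  replace (f z * (w - z))%C with ((f z * w + 0 * (w * w / 2 - z * w))
    - (f z * z + 0 * (z * z / 2 - z * z)))%C by ring.
  apply (seg_int_affine_approx f z w (f z) 0 z);
    [apply analytic_seg_continuous; assumption|].
  intros t Ht. pose proof (segpt_convex z w z t Ht) as Hs.
  assert (Hb : Cmod (segpt z w t - z) < d).
  { eapply Rle_lt_trans; [exact Hs|].
    replace (z - z)%C with (RtoC 0) by ring. rewrite Cmod_0.
    apply Rmax_lub_lt; [apply cond_pos|exact Hw]. }
  replace (f (segpt z w t) - (f z + 0 * (segpt z w t - z)))%C
    with (f (segpt z w t) - f z)%C by ring.
  apply Rlt_le, (Hd _ Hb).
Qed.

(** * The derivative of an analytic function is analytic *)

Lemma Cderive_ext_loc (f g : C -> C) (z l : C) :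
  @locally Cu z (fun w => f w = g w) -> Cderive f z l -> Cderive g z l.
Proof.
  intros E H. apply is_derive_iff_Cderive. apply is_derive_iff_Cderive in H.
  exact (is_derive_ext_loc f g z l E H).
Qed.

Lemma Cderive_ext_disc (f g : C -> C) (r : R) (z l : C) : Cmod z < r ->
  (forall w, Cmod w < r -> f w = g w) -> Cderive f z l -> Cderive g z l.
Proof.
  intros Hz E. apply Cderive_ext_loc. generalize (locally_disc z r Hz). apply filter_imp, E.
Qed.

Lemma Cderive_unique (f : C -> C) (z l m : C) : Cderive f z l -> Cderive f z m -> l = m.
Proof.
  intros H1 H2. apply is_derive_iff_Cderive in H1, H2.
  rewrite <- (is_C_derive_unique _ _ _ H1). apply is_C_derive_unique, H2.
Qed.

Lemma Cderive_cderiv (f : C -> C) (z l : C) : Cderive f z l -> cderiv f z = l.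
Proof. intros H. apply is_C_derive_unique, is_derive_iff_Cderive, H. Qed.

Lemma analytic_of_Cderive (f : C -> C) :
  (forall z, Cmod z < 1 -> exists l, Cderive f z l) -> analytic f.
Proof.
  intros H z Hz. destruct (H z Hz) as [l Hl]. exists l. apply is_derive_iff_Cderive, Hl.
Qed.

(** * Differentiation under the integral sign *)

(** The tube lemma: compactness of [[a, b]] makes a property that holds near every [(t, k0)] uniform
    in [t]. *)
Lemma compact_tube (a b : R) (Q : R -> C -> Prop) (k0 : C) :
  (forall t, a <= t <= b -> exists d, 0 < d /\
    forall s k, Rabs (s - t) < d -> Cmod (k - k0) < d -> Q s k) ->
  exists d, 0 < d /\ forall t k, a <= t <= b -> Cmod (k - k0) < d -> Q t k.
Proof.
  intros H.
  (* The compactness theorem takes a gauge on all of R; outside [[a, b]] the condition is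
     vacuous. *)
  set (delta := fun t => epsilon (inhabits (mkposreal 1 Rlt_0_1)) (fun d : posreal =>
    a <= t <= b -> forall s k, Rabs (s - t) < d -> Cmod (k - k0) < d -> Q s k)).
  assert (Hdelta : forall t, a <= t <= b ->
    forall s k, Rabs (s - t) < delta t -> Cmod (k - k0) < delta t -> Q s k).
  { intros t Ht. revert Ht.
    apply (epsilon_spec (inhabits (mkposreal 1 Rlt_0_1)) (fun d : posreal =>
      a <= t <= b -> forall s k, Rabs (s - t) < d -> Cmod (k - k0) < d -> Q s k)).
    destruct (classic (a <= t <= b)) as [Ht|Ht].
    - destruct (H t Ht) as (d & Hd & Hq). exists (mkposreal d Hd). intros _. exact Hq.
    - exists (mkposreal 1 Rlt_0_1). intros Ht'. contradiction. }
  destruct (compactness_value_1d a b delta) as [d Hd].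
  exists d. split; [apply cond_pos|]. intros t k Ht Hk.
  (* [compactness_value_1d] supplies its covering point only under a double negation. *)
  apply NNPP. intros HN. apply (Hd t Ht). intros (s & Hs & Hts & Hds).
  apply HN. apply (Hdelta s Hs); [exact Hts|lra].
Qed.

(** Both points may vary near [p]: the increment of [H] is the integral of [h] over [[y, x]], where
    [h] is within [eps] of [h y]. The derivative estimate is thus locally uniform, as the integral
    with parameter requires. *)
Lemma strict_derivative (H h : C -> C) (p : C) :
  (forall z, Cmod z < 1 -> Cderive H z (h z)) -> analytic h -> Cmod p < 1 ->
  forall eps, 0 < eps -> exists d, 0 < d /\ forall x y, Cmod (x - p) < d -> Cmod (y - p) < d ->
    Cmod x < 1 /\ Cmod (H x - H y - h y * (x - y)) <= eps * Cmod (x - y).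
Proof.
  intros HH Hh Hp eps He.
  pose proof (analytic_continuous_path (X := Cu) h (fun w => w) p Hh Hp (continuous_Cid p)) as Hc.
  destruct (filter_and _ _ (locally_disc p 1 Hp)
              (proj1 (continuous_Cu_eps _ _) Hc (eps / 2) ltac:(lra))) as [d Hd].
  exists d. split; [apply cond_pos|]. intros x y Hx Hy.
  destruct (Hd x Hx) as [Dx _]. destruct (Hd y Hy) as [Dy Ey]. split; [exact Dx|].
  pose proof (analytic_seg_continuous h y x Hh Dy Dx) as Hs.
  rewrite <- (seg_int_primitive H h y x); [| |exact Hs].
  2: { intros t Ht. apply HH, segpt_disc; assumption. }
  replace (h y * (x - y))%C with ((h y * x + 0 * (x * x / 2 - y * x))
    - (h y * y + 0 * (y * y / 2 - y * y)))%C by ring.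
  apply (seg_int_affine_approx h y x (h y) 0 y); [exact Hs|].
  intros t Ht. pose proof (segpt_convex y x p t Ht) as Hw.
  assert (Hb : Cmod (segpt y x t - p) < d).
  { eapply Rle_lt_trans; [exact Hw|apply Rmax_lub_lt; assumption]. }
  destruct (Hd _ Hb) as [_ E].
  replace (h (segpt y x t) - (h y + 0 * (segpt y x t - y)))%C
    with (h (segpt y x t) - h y)%C by ring.
  pose proof (Cmod_minus_triangle (h (segpt y x t)) (h p) (h y)) as T.
  rewrite (Cmod_minus_sym (h p)) in T. lra.
Qed.

(** The first-order error of the integrand is bounded uniformly in [t], by [strict_derivative] near
    each point of the path and [compact_tube] along it; the bound is then integrated. *)
Lemma Cderive_CRInt_param (H h : C -> C) (w u v : R -> C) (a b : R) (k0 : C) : a <= b ->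
  (forall z, Cmod z < 1 -> Cderive H z (h z)) -> analytic h ->
  (forall t, @continuous R_UniformSpace Cu w t) -> (forall t, @continuous R_UniformSpace Cu u t) ->
  (forall t, @continuous R_UniformSpace Cu v t) ->
  (forall t, Cmod (u t) <= 1) -> (forall t, Cmod (v t) <= 1) ->
  (forall t, a <= t <= b -> Cmod (w t + k0 * u t) < 1) ->
  Cderive (fun k => CRInt (fun t => H (w t + k * u t) * v t)%C a b) k0
    (CRInt (fun t => h (w t + k0 * u t) * u t * v t)%C a b).
Proof.
  intros Hab HH Hh Cw Cuu Cv Bu Bv HD.
  assert (AH : analytic H) by (apply analytic_of_Cderive; intros z Hz; exists (h z); auto).
  assert (Cp : forall k t, @continuous R_UniformSpace Cu (fun s => w s + k * u s)%C t).
  { intros k t. apply continuous_Cplus; [apply Cw|].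
    apply continuous_Cmult; [apply continuous_Cconst|apply Cuu]. }
  apply is_derive_wrt_of_eps; [intros y E; exact E|]. intros eps He.
  (* The error is integrated over a length [b - a]; the summand 1 keeps the denominator positive
     when [a = b]. *)
  set (e := eps / (b - a + 1)).
  assert (He' : 0 < e) by (apply Rdiv_lt_0_compat; lra).
  destruct (compact_tube a b (fun t k => Cmod (w t + k * u t) < 1 /\
    Cmod (H (w t + k * u t) - H (w t + k0 * u t) - h (w t + k0 * u t) * ((k - k0) * u t))
      <= e * Cmod (k - k0))%C k0) as (d & Hd & HQ).
  { intros t Ht.
    destruct (strict_derivative H h (w t + k0 * u t)%C HH Hh (HD t Ht) e He') as (d & Hd & HS).
    (* One [d / 2] is for the motion of the base point from [t] to [s], the other for the change of
       parameter from [k0] to [k]. *)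
    destruct (proj1 (continuous_Cu_eps _ t) (Cp k0 t) (d / 2) ltac:(lra)) as [d' Hd'].
    exists (Rmin d' (d / 2)). split; [apply Rmin_glb_lt; [apply cond_pos|lra]|].
    intros s k Hs Hk.
    assert (Hs' := Hd' s (Rlt_le_trans _ _ _ Hs (Rmin_l _ _))). cbv beta in Hs'.
    assert (Hk' := Rlt_le_trans _ _ _ Hk (Rmin_r _ _)).
    assert (E : (w s + k * u s - (w s + k0 * u s))%C = ((k - k0) * u s)%C) by ring.
    assert (Hu : Cmod ((k - k0) * u s) <= Cmod (k - k0)).
    { rewrite Cmod_mult. pose proof (Cmod_ge_0 (k - k0)). specialize (Bu s). nra. }
    destruct (HS (w s + k * u s)%C (w s + k0 * u s)%C) as [D1 D2]; [|lra|].
    - pose proof (Cmod_minus_triangle (w s + k * u s) (w s + k0 * u s) (w t + k0 * u t)) as T.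
      rewrite E in T. lra.
    - split; [exact D1|]. rewrite E in D2. eapply Rle_trans; [exact D2|].
      apply Rmult_le_compat_l; lra. }
  exists (mkposreal d Hd). intros k Hk. change (Cmod (k - k0) < d) in Hk.
  assert (IG : forall k, Cmod (k - k0) < d ->
    is_CRInt (fun t => H (w t + k * u t) * v t)%C a b
      (CRInt (fun t => H (w t + k * u t) * v t)%C a b)).
  { intros k' Hk'. apply is_CRInt_continuous; [exact Hab|]. intros t Ht.
    apply continuous_Cmult; [|apply Cv].
    apply (analytic_continuous_path H (fun t => w t + k' * u t)%C); [exact AH| |apply Cp].
    apply (HQ t k' Ht Hk'). }
  assert (Id : is_CRInt (fun t => h (w t + k0 * u t) * u t * v t)%C a b
    (CRInt (fun t => h (w t + k0 * u t) * u t * v t)%C a b)).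
  { apply is_CRInt_continuous; [exact Hab|]. intros t Ht.
    apply continuous_Cmult; [|apply Cv]. apply continuous_Cmult; [|apply Cuu].
    apply (analytic_continuous_path h (fun t => w t + k0 * u t)%C); [exact Hh| |apply Cp].
    apply HD, Ht. }
  assert (H00 : Cmod (k0 - k0) < d).
  { replace (k0 - k0)%C with (RtoC 0) by ring. rewrite Cmod_0. exact Hd. }
  pose proof (is_CRInt_minus _ _ _ _ _ _ (is_CRInt_minus _ _ _ _ _ _ (IG k Hk) (IG k0 H00))
                (is_CRInt_scal (k - k0) _ _ _ _ Id)) as I.
  rewrite (Cmult_comm _ (k - k0)).
  eapply Rle_trans; [apply (CRInt_bound _ a b (e * Cmod (k - k0)) _ Hab) with (2 := I)|].
  - intros t Ht. destruct (HQ t k Ht Hk) as [_ B].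
    match type of B with Cmod ?x <= _ => set (X := x) in B end.
    replace (H (w t + k * u t) * v t - H (w t + k0 * u t) * v t
      - (k - k0) * (h (w t + k0 * u t) * u t * v t))%C with (X * v t)%C by (unfold X; ring).
    rewrite Cmod_mult. pose proof (Cmod_ge_0 X). specialize (Bv t). nra.
  - pose proof (Cmod_ge_0 (k - k0)) as G.
    replace eps with (e * (b - a + 1)) by (unfold e; field; lra).
    assert (0 <= e * Cmod (k - k0)) by (apply Rmult_le_pos; lra). nra.
Qed.

(** * Integrals over circles *)

Lemma Pderive_cis_1 (t : R) : Pderive cis t (Ci * cis t)%C.
Proof.
  replace (Ci * cis t)%C with (- sin t, cos t).
  2: { unfold cis. apply injective_projections; simpl; ring. }
  apply Pderive_pair; [apply is_derive_cos|apply is_derive_sin].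
Qed.

Lemma continuous_cis_1 (t : R) : @continuous R_UniformSpace Cu cis t.
Proof.
  exact (is_derive_wrt_continuous RtoC _ _ _ (continuous_RtoC t) (Pderive_cis_1 t)).
Qed.

Lemma cis_0 : cis 0 = 1%C.
Proof. unfold cis. rewrite cos_0, sin_0. reflexivity. Qed.

Lemma cis_2PI : cis (2 * PI) = 1%C.
Proof. unfold cis. rewrite cos_2PI, sin_2PI. reflexivity. Qed.

Lemma cis_opp_nat_2PI (n : nat) : cis (- INR n * (2 * PI)) = 1%C.
Proof.
  unfold cis.
  rewrite <- (cos_period (- INR n * (2 * PI)) n), <- (sin_period (- INR n * (2 * PI)) n).
  replace (- INR n * (2 * PI) + 2 * INR n * PI) with 0 by ring.
  rewrite cos_0, sin_0. reflexivity.
Qed.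

Lemma two_PI_ge_0 : 0 <= 2 * PI.
Proof. pose proof PI_RGT_0. lra. Qed.

Lemma circle_disc (z : C) (r t : R) : 0 <= r -> Cmod z + r < 1 ->
  Cmod (z + RtoC r * cis t) < 1.
Proof.
  intros Hr H. eapply Rle_lt_trans; [apply Cmod_triangle|].
  rewrite Cmod_mult, Cmod_cis, Cmod_R, Rabs_right by lra. lra.
Qed.

Lemma Pderive_circle (F f : C -> C) (z k : C) (t : R) :
  (forall z, Cmod z < 1 -> Cderive F z (f z)) -> Cmod (z + k * cis t) < 1 ->
  Pderive (fun t => F (z + k * cis t))%C t (f (z + k * cis t) * (k * (Ci * cis t)))%C.
Proof.
  intros HF Hd.
  apply (is_derive_wrt_comp RtoC F (fun t => z + k * cis t)%C);
    [apply continuous_RtoC|apply HF, Hd|].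
  replace (k * (Ci * cis t))%C with (0 + k * (Ci * cis t))%C by ring.
  apply is_derive_wrt_plus; [apply is_derive_wrt_const|].
  apply is_derive_wrt_scal, Pderive_cis_1.
Qed.

Lemma continuous_circle (f : C -> C) (z k : C) (t : R) :
  analytic f -> Cmod (z + k * cis t) < 1 ->
  @continuous R_UniformSpace Cu (fun t => f (z + k * cis t))%C t.
Proof.
  intros Hf Hd. apply (analytic_continuous_path f (fun t => z + k * cis t)%C); [exact Hf|exact Hd|].
  apply continuous_Cplus; [apply continuous_Cconst|].
  apply continuous_Cmult; [apply continuous_Cconst|apply continuous_cis_1].
Qed.

Lemma Cminus_eq_0 (a b : C) : (a - b)%C = 0%C -> a = b.
Proof. intros E. replace a with ((a - b) + b)%C by ring. rewrite E. ring. Qed.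

(** The integral [psi k] of [F(z + k e^(it))], with a complex radius [k], has derivative zero: for
    [k <> 0] the differentiated integrand is a multiple of the [t]-derivative of [F(z + k e^(it))],
    whose integral over a full turn vanishes. So [psi] takes the same value at [r] as at 0. *)
Lemma mean_value (F f : C -> C) (z : C) (r : R) :
  (forall z, Cmod z < 1 -> Cderive F z (f z)) -> analytic f -> 0 <= r -> Cmod z + r < 1 ->
  is_CRInt (fun t => F (z + RtoC r * cis t))%C 0 (2 * PI) (RtoC (2 * PI) * F z)%C.
Proof.
  intros HF Hf Hr Hz. pose proof two_PI_ge_0 as Hpi.
  assert (AF : analytic F) by (apply analytic_of_Cderive; intros w Hw; exists (f w); auto).
  assert (HD : forall k t, Cmod k <= r -> Cmod (z + k * cis t) < 1).
  { intros k t Hk. eapply Rle_lt_trans; [apply Cmod_triangle|].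
    rewrite Cmod_mult, Cmod_cis. lra. }
  (* The final factor 1 gives the integrand the shape of [Cderive_CRInt_param] with constant [v]. *)
  set (J := fun k => CRInt (fun t => f (z + k * cis t) * cis t * 1)%C 0 (2 * PI)).
  assert (HJ : forall k, Cmod k <= r -> J k = RtoC 0).
  { intros k Hk. apply is_CRInt_unique.
    assert (Cc : forall t, @continuous R_UniformSpace Cu (fun t => Ci * cis t)%C t).
    { intros t. apply continuous_Cmult; [apply continuous_Cconst|apply continuous_cis_1]. }
    assert (Ici : (Ci <> 0)%C) by (intros E; injection E; lra).
    (* At [k = 0] one cannot divide by [k]; there the integrand is [f z] times [e^(it)], which has
       its own periodic primitive. *)
    destruct (classic (k = 0%C)) as [->|Hk0].
    - pose proof (is_CRInt_Pderive _ _ 0 (2 * PI) Hpi (fun t _ => Pderive_cis_1 t)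
                    (fun t _ => Cc t)) as I.
      apply (is_CRInt_scal (f z / Ci)) in I.
      rewrite cis_2PI, cis_0 in I.
      replace (f z / Ci * (1 - 1))%C with (RtoC 0) in I by ring.
      revert I. apply is_CRInt_ext; [exact Hpi|]. intros t _.
      replace (z + 0 * cis t)%C with z by ring. field. exact Ici.
    - assert (I : is_CRInt (fun t => f (z + k * cis t) * (k * (Ci * cis t)))%C 0 (2 * PI)
                    (F (z + k * cis (2 * PI)) - F (z + k * cis 0))%C).
      { apply (is_CRInt_Pderive (fun t => F (z + k * cis t))%C); [exact Hpi| |].
        - intros t _. apply Pderive_circle; [exact HF|apply HD, Hk].
        - intros t _. apply continuous_Cmult; [apply continuous_circle; [exact Hf|apply HD, Hk]|].
          apply continuous_Cmult; [apply continuous_Cconst|apply Cc]. }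
      apply (is_CRInt_scal (/ (k * Ci))) in I. rewrite cis_2PI, cis_0 in I.
      replace (/ (k * Ci) * (F (z + k * 1) - F (z + k * 1)))%C with (RtoC 0) in I by ring.
      revert I. apply is_CRInt_ext; [exact Hpi|]. intros t _. field. split; assumption. }
  set (psi := fun k => CRInt (fun t => F (z + k * cis t) * 1)%C 0 (2 * PI)).
  assert (Hpsi : forall k, Cmod k <= r -> Cderive psi k 0%C).
  { intros k Hk. rewrite <- (HJ k Hk).
    apply (Cderive_CRInt_param F f (fun _ => z) cis (fun _ => 1%C));
      [exact Hpi|exact HF|exact Hf| | | | | |].
    - intros; apply continuous_Cconst.
    - apply continuous_cis_1.
    - intros; apply continuous_Cconst.
    - intros t; rewrite Cmod_cis; lra.
    - intros t; rewrite Cmod_1; lra.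
    - intros t _. apply HD, Hk. }
  (* Both sides are the integral of the zero function over [[0, r]]: the left one through the
     primitive [psi], the right one directly. *)
  assert (Hconst : (psi (RtoC r) - psi (RtoC 0))%C = 0%C).
  { apply (is_CRInt_functional (fun _ => 0%C) 0 r).
    - apply (is_CRInt_Pderive (fun s => psi (RtoC s))); [exact Hr| |].
      + intros t Ht. replace (RtoC 0) with (0 * 1)%C by ring.
        apply is_derive_wrt_comp; [apply continuous_RtoC| |apply is_derive_wrt_id].
        apply Hpsi. rewrite Cmod_R, Rabs_right; lra.
      + intros t _. apply continuous_Cconst.
    - pose proof (is_CRInt_const 0%C 0 r) as I.
      replace (RtoC (r - 0) * 0)%C with (RtoC 0) in I by ring. exact I. }
  assert (H0 : psi (RtoC 0) = (RtoC (2 * PI) * F z)%C).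
  { apply is_CRInt_unique. replace (2 * PI) with (2 * PI - 0) at 2 by ring.
    apply (is_CRInt_ext (fun _ => F z) _ _ _ _ Hpi); [|apply is_CRInt_const].
    intros t _. replace (z + 0 * cis t)%C with z by ring. ring. }
  assert (HI : is_CRInt (fun t => F (z + RtoC r * cis t))%C 0 (2 * PI)
                 (CRInt (fun t => F (z + RtoC r * cis t))%C 0 (2 * PI))).
  { apply is_CRInt_continuous; [exact Hpi|]. intros t _.
    apply continuous_circle; [exact AF|]. apply circle_disc; assumption. }
  replace (RtoC (2 * PI) * F z)%C with (CRInt (fun t => F (z + RtoC r * cis t))%C 0 (2 * PI));
    [exact HI|].
  replace (RtoC (2 * PI) * F z)%C with (psi (RtoC r)).
  - symmetry. apply is_CRInt_unique. revert HI. apply is_CRInt_ext; [exact Hpi|].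
    intros t _. ring.
  - rewrite <- H0. apply Cminus_eq_0, Hconst.
Qed.

(** A Fourier coefficient on the circle of radius [r] about [z]; for analytic [F] it equals
    [2 pi r^n F^(n)(z) / n!], which explains the factor [(n + 1) / r] in its derivative. *)
Definition circle_coeff (F : C -> C) (r : R) (n : nat) (z : C) : C :=
  CRInt (fun t => F (z + RtoC r * cis t) * cis (- INR n * t))%C 0 (2 * PI).

(* Differentiation under the integral gives the integral of [f(z + r e^(it)) e^(-int)], and an
   integration by parts against [e^(-i(n+1)t)] trades [f] for [F]. *)
Lemma Cderive_circle_coeff (F f : C -> C) (r : R) (n : nat) (z : C) :
  (forall z, Cmod z < 1 -> Cderive F z (f z)) -> analytic f -> 0 < r -> Cmod z + r < 1 ->
  Cderive (circle_coeff F r n) z (RtoC (INR (S n) / r) * circle_coeff F r (S n) z)%C.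
Proof.
  intros HF Hf Hr Hz. pose proof two_PI_ge_0 as Hpi.
  assert (AF : analytic F) by (apply analytic_of_Cderive; intros w Hw; exists (f w); auto).
  assert (HD : forall t, Cmod (z + RtoC r * cis t) < 1) by (intros; apply circle_disc; lra).
  set (D := CRInt (fun t => f (z + RtoC r * cis t) * cis (- INR n * t))%C 0 (2 * PI)).
  assert (ID : is_CRInt (fun t => f (z + RtoC r * cis t) * cis (- INR n * t))%C 0 (2 * PI) D).
  { apply is_CRInt_continuous; [exact Hpi|]. intros t _.
    apply continuous_Cmult; [apply continuous_circle; auto|apply continuous_cis]. }
  assert (IA : is_CRInt (fun t => F (z + RtoC r * cis t) * cis (- INR (S n) * t))%C 0 (2 * PI)
                 (circle_coeff F r (S n) z)).
  { apply is_CRInt_continuous; [exact Hpi|]. intros t _.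
    apply continuous_Cmult; [apply continuous_circle; auto|apply continuous_cis]. }
  (* The [t]-derivative of [F(z + r e^(it)) e^(-i(n+1)t)] integrates to zero by periodicity; the
     factor [e^(it)] from the circle lowers [n + 1] to [n] in the term with [f]. *)
  assert (E : (RtoC r * Ci * D - Ci * RtoC (INR (S n)) * circle_coeff F r (S n) z)%C = 0%C).
  { apply (is_CRInt_functional _ _ _ _ _ (is_CRInt_minus _ _ _ _ _ _
      (is_CRInt_scal (RtoC r * Ci)%C _ _ _ _ ID)
      (is_CRInt_scal (Ci * RtoC (INR (S n)))%C _ _ _ _ IA))).
    assert (I : is_CRInt (fun t => f (z + RtoC r * cis t) * (RtoC r * (Ci * cis t))
        * cis (- INR (S n) * t) + F (z + RtoC r * cis t)
        * (Ci * RtoC (- INR (S n)) * cis (- INR (S n) * t)))%C 0 (2 * PI)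
      (F (z + RtoC r * cis (2 * PI)) * cis (- INR (S n) * (2 * PI))
        - F (z + RtoC r * cis 0) * cis (- INR (S n) * 0))%C).
    { apply (is_CRInt_Pderive (fun t => F (z + RtoC r * cis t) * cis (- INR (S n) * t))%C);
        [exact Hpi| |].
      - intros t _.
        apply (is_derive_wrt_mult RtoC (fun t => F (z + RtoC r * cis t))%C
                 (fun t => cis (- INR (S n) * t)));
          [apply continuous_RtoC| |apply Pderive_cis].
        apply Pderive_circle; auto.
      - intros t _. apply continuous_Cplus; apply continuous_Cmult.
        + apply continuous_Cmult; [apply continuous_circle; auto|].
          apply continuous_Cmult; [apply continuous_Cconst|].
          apply continuous_Cmult; [apply continuous_Cconst|apply continuous_cis_1].
        + apply continuous_cis.
        + apply continuous_circle; auto.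
        + apply continuous_Cmult; [apply continuous_Cconst|apply continuous_cis]. }
    rewrite cis_2PI, cis_0, cis_opp_nat_2PI, Rmult_0_r, cis_0 in I.
    replace (F (z + RtoC r * 1) * 1 - F (z + RtoC r * 1) * 1)%C with (RtoC 0) in I by ring.
    revert I. apply is_CRInt_ext; [exact Hpi|]. intros t _.
    replace (cis (- INR n * t)) with (cis t * cis (- INR (S n) * t))%C.
    2: { rewrite cis_plus. f_equal. rewrite S_INR. ring. }
    rewrite RtoC_opp. ring. }
  assert (ED : D = (RtoC (INR (S n) / r) * circle_coeff F r (S n) z)%C).
  { assert (Ici : (Ci <> 0)%C) by (intros E0; injection E0; lra).
    assert (Hr0 : RtoC r <> 0%C) by (intros E0; injection E0; lra).
    rewrite RtoC_div by lra.
    apply Cminus_eq_0.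
    replace (D - RtoC (INR (S n)) / RtoC r * circle_coeff F r (S n) z)%C
      with ((RtoC r * Ci * D - Ci * RtoC (INR (S n)) * circle_coeff F r (S n) z)
            / (RtoC r * Ci))%C by (field; split; assumption).
    rewrite E. unfold Cdiv. ring. }
  rewrite <- ED.
  (* Here the parameter is the centre: the circle [r e^(it)] plays the role of [w], and [u] is the
     constant 1. *)
  apply (Cderive_ext_disc (fun k => CRInt (fun t => F (RtoC r * cis t + k * 1)
           * cis (- INR n * t))%C 0 (2 * PI)) _ 1); [lra| |].
  { intros w _. apply (@RInt_ext C_R_CompleteNormedModule). intros t _.
    replace (RtoC r * cis t + w * 1)%C with (w + RtoC r * cis t)%C by ring. reflexivity. }
  replace D with (CRInt (fun t => f (RtoC r * cis t + z * 1) * 1 * cis (- INR n * t))%C 0 (2 * PI)).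
  2: { apply is_CRInt_unique. revert ID. apply is_CRInt_ext; [exact Hpi|]. intros t _.
       replace (RtoC r * cis t + z * 1)%C with (z + RtoC r * cis t)%C by ring. ring. }
  apply (Cderive_CRInt_param F f (fun t => RtoC r * cis t)%C (fun _ => 1%C)
    (fun t => cis (- INR n * t))); [exact Hpi|exact HF|exact Hf| | | | | |].
  - intros t. apply continuous_Cmult; [apply continuous_Cconst|apply continuous_cis_1].
  - intros; apply continuous_Cconst.
  - apply continuous_cis.
  - intros t; rewrite Cmod_1; lra.
  - intros t; rewrite Cmod_cis; lra.
  - intros t _. replace (RtoC r * cis t + z * 1)%C with (z + RtoC r * cis t)%C by ring. apply HD.
Qed.

(* Near [z], a primitive [F] of [f] is a multiple of [circle_coeff F r 0], hence three times
   differentiable. *)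
Lemma analytic_cderiv (f : C -> C) : analytic f -> analytic (cderiv f).
Proof.
  intros Hf. apply analytic_of_Cderive. intros z Hz.
  (* Half the distance to the boundary: circles of radius [r] about all points of [Cmod w < 1 - r],
     a neighbourhood of [z], stay in the unit disc. *)
  set (r := (1 - Cmod z) / 2). assert (Hr : 0 < r) by (unfold r; lra).
  assert (Hzr : Cmod z < 1 - r) by (unfold r; lra).
  set (F := seg_int f 0).
  assert (HF : forall w, Cmod w < 1 -> Cderive F w (f w)).
  { intros w Hw. apply analytic_primitive; assumption. }
  assert (Hpi : RtoC (2 * PI) <> 0%C).
  { intros E. injection E. pose proof PI_RGT_0. lra. }
  assert (HA : forall n w, Cmod w < 1 - r ->
    Cderive (circle_coeff F r n) w (RtoC (INR (S n) / r) * circle_coeff F r (S n) w)%C).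
  { intros n w Hw. apply (Cderive_circle_coeff F f); auto. lra. }
  (* The factor [1 / (2 pi)] of the mean times the factor [1 / r] of the first differentiation; [c2]
     below gains [2 / r] from the second. *)
  set (c1 := (/ RtoC (2 * PI) * RtoC (INR 1 / r))%C).
  assert (E0 : forall w, Cmod w < 1 - r -> (/ RtoC (2 * PI) * circle_coeff F r 0 w)%C = F w).
  { intros w Hw.
    assert (E : circle_coeff F r 0 w = (RtoC (2 * PI) * F w)%C).
    { apply is_CRInt_unique.
      apply (is_CRInt_ext _ _ _ _ _ two_PI_ge_0) with (2 := mean_value F f w r HF Hf ltac:(lra)
        ltac:(lra)).
      intros t _. simpl INR. replace (- 0 * t) with 0 by ring. rewrite cis_0. ring. }
    rewrite E. field. exact Hpi. }
  assert (E1 : forall w, Cmod w < 1 - r -> (c1 * circle_coeff F r 1 w)%C = f w).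
  { intros w Hw. apply (Cderive_unique F w); [|apply HF; lra].
    apply (Cderive_ext_disc (fun w => / RtoC (2 * PI) * circle_coeff F r 0 w)%C _ _ _ _ Hw E0).
    unfold c1. rewrite <- Cmult_assoc. apply is_derive_wrt_scal, HA, Hw. }
  set (c2 := (c1 * RtoC (INR 2 / r))%C).
  assert (E2 : forall w, Cmod w < 1 - r -> (c2 * circle_coeff F r 2 w)%C = cderiv f w).
  { intros w Hw. symmetry. apply Cderive_cderiv.
    apply (Cderive_ext_disc (fun w => c1 * circle_coeff F r 1 w)%C _ _ _ _ Hw E1).
    unfold c2. rewrite <- Cmult_assoc. apply is_derive_wrt_scal, HA, Hw. }
  eexists. apply (Cderive_ext_disc (fun w => c2 * circle_coeff F r 2 w)%C _ _ _ _ Hzr E2).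
  apply is_derive_wrt_scal, HA, Hzr.
Qed.

(** * Hardy space estimates *)

Lemma rpow_pos (x p : R) : 0 < x -> rpow x p = Rpower x p.
Proof. intros Hx. unfold rpow. destruct (Rle_dec x 0); [lra|reflexivity]. Qed.

Lemma rpow_neg (x p : R) : x <= 0 -> rpow x p = 0.
Proof. intros Hx. unfold rpow. destruct (Rle_dec x 0); [reflexivity|contradiction]. Qed.

Lemma rpow_ge_0 (x p : R) : 0 <= rpow x p.
Proof.
  unfold rpow. destruct (Rle_dec x 0); [lra|]. apply Rlt_le, exp_pos.
Qed.

Lemma rpow_le (x y p : R) : 0 <= p -> x <= y -> rpow x p <= rpow y p.
Proof.
  intros Hp Hxy. destruct (Rle_lt_dec x 0) as [Hx|Hx].
  - rewrite (rpow_neg x) by assumption. apply rpow_ge_0.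
  - rewrite !rpow_pos by lra. apply Rle_Rpower_l; lra.
Qed.

Lemma rpow_mult (x y p : R) : 0 <= x -> 0 <= y -> rpow (x * y) p = rpow x p * rpow y p.
Proof.
  intros Hx Hy. destruct (Req_dec x 0) as [->|Hx0].
  { rewrite Rmult_0_l, (rpow_neg 0) by lra. ring. }
  destruct (Req_dec y 0) as [->|Hy0].
  { rewrite Rmult_0_r, (rpow_neg 0) by lra. ring. }
  rewrite !rpow_pos by (try apply Rmult_lt_0_compat; lra).
  symmetry. apply Rpower_mult_distr; lra.
Qed.

Lemma rpow_rpow_inverse (x p q : R) : 0 <= x -> p * q = 1 -> rpow (rpow x p) q = x.
Proof.
  intros Hx Hpq. destruct (Req_dec x 0) as [->|Hx0].
  { rewrite (rpow_neg 0 p), rpow_neg by lra. reflexivity. }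
  rewrite (rpow_pos x) by lra. rewrite rpow_pos by apply exp_pos.
  rewrite Rpower_mult, Hpq. apply Rpower_1. lra.
Qed.

Lemma rpow_ge_id (x p : R) : 1 <= p -> 1 <= x -> x <= rpow x p.
Proof.
  intros Hp Hx. rewrite rpow_pos by lra. rewrite <- (Rpower_1 x) at 1 by lra.
  apply Rle_Rpower; lra.
Qed.

(** This is [rpow_ge_id] at [/ x], turned around by multiplicativity. *)
Lemma rpow_le_id (x p : R) : 1 <= p -> 0 <= x <= 1 -> rpow x p <= x.
Proof.
  intros Hp Hx. destruct (Req_dec x 0) as [->|Hx0]; [rewrite rpow_neg; lra|].
  assert (Hi : 1 <= / x) by (rewrite <- Rinv_1; apply Rinv_le_contravar; lra).
  pose proof (rpow_ge_id (/ x) p Hp Hi) as H.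
  assert (E : rpow x p * rpow (/ x) p = 1).
  { rewrite <- rpow_mult by lra. rewrite Rinv_r by lra.
    rewrite rpow_pos by lra. unfold Rpower. rewrite ln_1, Rmult_0_r. apply exp_0. }
  pose proof (rpow_ge_0 x p).
  apply (Rmult_le_reg_r (/ x)); [lra|]. rewrite Rinv_r by lra. nra.
Qed.

(** The delicate point is 0, where [y ^ p] is squeezed between 0 and [y] because [1 <= p]. *)
Lemma continuous_rpow (p x : R) : 1 <= p -> continuous (fun y => rpow y p) x.
Proof.
  intros Hp. destruct (Rtotal_order x 0) as [Hx|[->|Hx]].
  - apply (continuous_ext_loc _ (fun _ => 0)); [|apply continuous_const].
    generalize (open_lt 0 x Hx). apply filter_imp. intros y Hy. rewrite rpow_neg; lra.
  - unfold continuous. apply filterlim_locally. intros eps.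
    exists (mkposreal (Rmin eps 1) (Rmin_glb_lt _ _ _ (cond_pos eps) Rlt_0_1)).
    intros y Hy. change (Rabs (y - 0) < Rmin eps 1) in Hy.
    change (Rabs (rpow y p - rpow 0 p) < eps).
    pose proof (Rmin_l eps 1). pose proof (Rmin_r eps 1). pose proof (Rle_abs (y - 0)).
    rewrite (rpow_neg 0) by lra. rewrite Rminus_0_r, Rabs_right by (apply Rle_ge, rpow_ge_0).
    destruct (Rle_lt_dec y 0) as [Hy0|Hy0].
    + rewrite rpow_neg by assumption. apply cond_pos.
    + pose proof (rpow_le_id y p Hp). lra.
  - apply (continuous_ext_loc _ (fun y => exp (p * ln y))).
    + generalize (open_gt 0 x Hx). apply filter_imp. intros y Hy. rewrite rpow_pos; auto.
    + apply (ex_derive_continuous (K := R_AbsRing) (V := R_NormedModule)). auto_derive. exact Hx.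
Qed.

(** Either [x <= l], or [x / l] exceeds 1 and is at most its own [p]-th power. *)
Lemma rpow_linear_bound (p l x : R) : 1 <= p -> 0 < l -> 0 <= x ->
  x <= l + l / rpow l p * rpow x p.
Proof.
  intros Hp Hl Hx.
  assert (Hlp : 0 < rpow l p) by (rewrite rpow_pos by assumption; apply exp_pos).
  assert (H0 : 0 <= l / rpow l p * rpow x p).
  { apply Rmult_le_pos; [apply Rlt_le, Rdiv_lt_0_compat; assumption|apply rpow_ge_0]. }
  destruct (Rle_lt_dec x l) as [H|H]; [lra|].
  assert (H1 : 1 <= x / l) by (apply Rle_div_r; lra).
  pose proof (rpow_ge_id _ _ Hp H1) as H2.
  assert (E : rpow x p = rpow (x / l) p * rpow l p).
  { rewrite <- rpow_mult by lra. f_equal. field. lra. }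
  rewrite E.
  replace (l / rpow l p * (rpow (x / l) p * rpow l p)) with (l * rpow (x / l) p) by (field; lra).
  assert (x = l * (x / l)) by (field; lra). nra.
Qed.

(** The sum is at most twice the larger term, which gives the constant [2 ^ p] without convexity. *)
Lemma rpow_plus_le (p x y : R) : 0 <= p -> 0 <= x -> 0 <= y ->
  rpow (x + y) p <= rpow 2 p * (rpow x p + rpow y p).
Proof.
  intros Hp Hx Hy. pose proof (rpow_ge_0 x p). pose proof (rpow_ge_0 y p).
  pose proof (rpow_ge_0 2 p).
  destruct (Rle_lt_dec x y).
  - apply (Rle_trans _ (rpow (2 * y) p)); [apply rpow_le; lra|].
    rewrite rpow_mult by lra. nra.
  - apply (Rle_trans _ (rpow (2 * x) p)); [apply rpow_le; lra|].
    rewrite rpow_mult by lra. nra.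
Qed.

(** * Integral means over circles and the Hardy norm *)

Lemma polar_circle (r t : R) : polar r t = (0 + RtoC r * cis t)%C.
Proof. rewrite polar_cis. ring. Qed.

Lemma Cmod_polar_lt_1 (r t : R) : 0 <= r < 1 -> Cmod (0 + RtoC r * cis t) < 1.
Proof. intros Hr. apply circle_disc; [|rewrite Cmod_0]; lra. Qed.

Lemma continuous_polar (f : C -> C) (r t : R) : analytic f -> 0 <= r < 1 ->
  @continuous R_UniformSpace Cu (fun s => f (polar r s)) t.
Proof.
  intros Hf Hr. apply (@continuous_ext R_UniformSpace Cu (fun s => f (0 + RtoC r * cis s))%C).
  { intros s. rewrite polar_circle. reflexivity. }
  apply continuous_circle; [exact Hf|apply Cmod_polar_lt_1, Hr].
Qed.

Lemma continuous_Cmod_polar (f : C -> C) (r t : R) : analytic f -> 0 <= r < 1 ->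
  continuous (fun s => Cmod (f (polar r s))) t.
Proof. intros Hf Hr. apply continuous_Cmod, continuous_polar; assumption. Qed.

Lemma is_RInt_Mp (p : R) (f : C -> C) (r : R) : 1 <= p -> analytic f -> 0 <= r < 1 ->
  is_RInt (fun t => rpow (Cmod (f (polar r t))) p) 0 (2 * PI) (2 * PI * Mp p f r).
Proof.
  intros Hp Hf Hr. unfold Mp. rewrite <- Rmult_assoc, Rinv_r, Rmult_1_l
    by (pose proof PI_RGT_0; lra).
  apply (RInt_correct (V := R_CompleteNormedModule)).
  apply (ex_RInt_continuous (V := R_CompleteNormedModule)). intros t _.
  apply (continuous_comp (fun t => Cmod (f (polar r t))) (fun y => rpow y p));
    [apply continuous_Cmod_polar; assumption|apply continuous_rpow, Hp].
Qed.

Lemma is_RInt_nonneg (f : R -> R) (a b l : R) : a <= b ->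
  (forall t, a <= t <= b -> 0 <= f t) -> is_RInt f a b l -> 0 <= l.
Proof.
  intros Hab H Hf. rewrite <- (is_RInt_unique _ _ _ _ Hf).
  apply RInt_ge_0; [exact Hab|exists l; exact Hf|]. intros t Ht. apply H. lra.
Qed.

Lemma is_RInt_le (f g : R -> R) (a b l m : R) : a <= b ->
  (forall t, a <= t <= b -> f t <= g t) -> is_RInt f a b l -> is_RInt g a b m -> l <= m.
Proof.
  intros Hab H Hf Hg. rewrite <- (is_RInt_unique _ _ _ _ Hf), <- (is_RInt_unique _ _ _ _ Hg).
  apply RInt_le; [exact Hab|exists l; exact Hf|exists m; exact Hg|]. intros t Ht. apply H. lra.
Qed.

Lemma Mp_ge_0 (p : R) (f : C -> C) (r : R) : 1 <= p -> analytic f -> 0 <= r < 1 -> 0 <= Mp p f r.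
Proof.
  intros Hp Hf Hr. pose proof PI_RGT_0.
  pose proof (is_RInt_nonneg _ _ _ _ two_PI_ge_0 (fun t _ => rpow_ge_0 _ p)
                (is_RInt_Mp p f r Hp Hf Hr)). nra.
Qed.

Lemma Mp_ext (p : R) (f g : C -> C) (r : R) : 0 <= r < 1 ->
  (forall z, Cmod z < 1 -> f z = g z) -> Mp p f r = Mp p g r.
Proof.
  intros Hr E. unfold Mp. f_equal. apply RInt_ext. intros t _. rewrite E; [reflexivity|].
  rewrite polar_circle. apply Cmod_polar_lt_1, Hr.
Qed.

Lemma analytic_ext (f g : C -> C) :
  (forall z, Cmod z < 1 -> f z = g z) -> analytic f -> analytic g.
Proof.
  intros E Hf. apply analytic_of_Cderive. intros z Hz. exists (cderiv f z).
  apply (Cderive_ext_disc f g 1 z _ Hz E). apply (proj1 (analytic_iff f) Hf z Hz).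
Qed.

(** Formulas for derivatives are available only inside the disc, whereas functions here are total;
    membership in [H^p] must pass between functions that agree on the disc. *)
Lemma in_Hp_ext (p : R) (f g : C -> C) :
  (forall z, Cmod z < 1 -> f z = g z) -> in_Hp p f -> in_Hp p g.
Proof.
  intros E [Hf Hs]. split; [apply (analytic_ext f g E Hf)|].
  replace (Hp_sup p g) with (Hp_sup p f); [exact Hs|].
  apply Lub_Rbar_eqset. intros x.
  split; intros (r & Hr & ->); exists r; (split; [exact Hr|]); [|symmetry]; apply Mp_ext; auto; lra.
Qed.

Lemma Hp_norm_ge_0 (p : R) (f : C -> C) : 0 <= Hp_norm p f.
Proof. apply rpow_ge_0. Qed.

Lemma Mp_le_Hp_norm (p : R) (f : C -> C) (r : R) : 1 <= p -> in_Hp p f -> 0 < r < 1 ->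
  Mp p f r <= rpow (Hp_norm p f) p.
Proof.
  intros Hp [Hf Hs] Hr.
  destruct (Lub_Rbar_correct (fun x => exists r, 0 < r < 1 /\ x = Mp p f r)) as [Hub _].
  fold (Hp_sup p f) in Hub. rewrite <- Hs in Hub.
  assert (HM : Mp p f r <= real (Hp_sup p f)) by (apply Hub; exists r; auto).
  pose proof (Mp_ge_0 p f r Hp Hf ltac:(lra)).
  unfold Hp_norm. rewrite rpow_rpow_inverse; [exact HM|lra|field; lra].
Qed.

Lemma Hp_norm_le (p K : R) (f : C -> C) : 1 <= p -> 0 <= K -> analytic f ->
  (forall r, 0 < r < 1 -> Mp p f r <= rpow K p) -> in_Hp p f /\ Hp_norm p f <= K.
Proof.
  intros Hp HK Hf H.
  destruct (Lub_Rbar_correct (fun x => exists r, 0 < r < 1 /\ x = Mp p f r)) as [Hub Hlub].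
  fold (Hp_sup p f) in Hub, Hlub.
  assert (H1 : Rbar_le (Hp_sup p f) (rpow K p)).
  { apply Hlub. intros x (r & Hr & ->). apply H, Hr. }
  (* Any radius shows that the supremum is not minus infinity. *)
  assert (H2 : Rbar_le (Mp p f (1 / 2)) (Hp_sup p f)).
  { apply Hub. exists (1 / 2). split; [lra|reflexivity]. }
  assert (Hfin : is_finite (Hp_sup p f)).
  { destruct (Hp_sup p f); [reflexivity|contradiction|contradiction]. }
  split; [split; assumption|].
  rewrite <- Hfin in H1. unfold Hp_norm.
  rewrite <- (rpow_rpow_inverse K p (/ p)) by (try lra; field; lra).
  apply rpow_le; [apply Rlt_le, Rinv_0_lt_compat; lra|exact H1].
Qed.

(* [H^p] is contained in [H^1]; the constant 2 replaces Jensen's inequality by the pointwise bound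
   [rpow_linear_bound] with [l] slightly above the norm. *)
Lemma RInt_Cmod_le_Hp_norm (p : R) (f : C -> C) (r l : R) : 1 <= p -> in_Hp p f -> 0 < r < 1 ->
  is_RInt (fun t => Cmod (f (polar r t))) 0 (2 * PI) l -> l <= 4 * PI * Hp_norm p f.
Proof.
  intros Hp Hf Hr Hl. pose proof PI_RGT_0 as Hpi.
  apply le_epsilon. intros eps He.
  set (N := Hp_norm p f). assert (HN : 0 <= N) by apply Hp_norm_ge_0.
  (* The pointwise bound needs a positive level, and [N] may be 0. Both of its terms integrate to at
     most [2 * PI * k], so this choice costs exactly [eps]. *)
  set (k := N + eps / (4 * PI)).
  assert (He' : 0 < eps / (4 * PI)) by (apply Rdiv_lt_0_compat; lra).
  assert (Hk : 0 < k) by (unfold k; lra).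
  assert (HM : Mp p f r <= rpow k p).
  { eapply Rle_trans; [apply Mp_le_Hp_norm; assumption|]. apply rpow_le; unfold k, N in *; lra. }
  assert (Hkp : 0 < rpow k p) by (rewrite rpow_pos by assumption; apply exp_pos).
  pose proof (is_RInt_plus _ _ 0 (2 * PI) _ _ (is_RInt_const 0 (2 * PI) k)
    (is_RInt_scal _ 0 (2 * PI) (k / rpow k p) _
      (is_RInt_Mp p f r Hp (proj1 Hf) ltac:(lra)))) as I.
  eapply Rle_trans.
  - apply (is_RInt_le _ _ 0 (2 * PI) _ _ two_PI_ge_0) with (2 := Hl) (3 := I).
    intros t _. apply rpow_linear_bound; [exact Hp|exact Hk|apply Cmod_ge_0].
  - change ((2 * PI - 0) * k + k / rpow k p * (2 * PI * Mp p f r) <= 4 * PI * N + eps).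
    replace (4 * PI * N + eps) with (4 * PI * k) by (unfold k; field; lra).
    assert (k / rpow k p * (2 * PI * Mp p f r) <= k / rpow k p * (2 * PI * rpow k p)).
    { apply Rmult_le_compat_l; [apply Rlt_le, Rdiv_lt_0_compat; assumption|nra]. }
    replace (k / rpow k p * (2 * PI * rpow k p)) with (2 * PI * k) in H by (field; lra).
    lra.
Qed.

(* The oscillation of [f] on a circle is at most its total variation there, which is an integral
   of [|f'|]; the mean of [f] over the circle is [f 0]. *)
Lemma Cmod_le_Hp_norm_cderiv (p : R) (f : C -> C) (r s : R) : 1 <= p -> analytic f ->
  in_Hp p (cderiv f) -> 0 < r < 1 -> 0 <= s <= 2 * PI ->
  Cmod (f (polar r s)) <= Cmod (f 0) + 4 * PI * Hp_norm p (cderiv f).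
Proof.
  intros Hp Hf Hd Hr Hs. pose proof PI_RGT_0 as Hpi.
  pose proof (proj1 (analytic_iff f) Hf) as Hder. pose proof (proj1 Hd) as Hdf.
  assert (Hr' : 0 <= r < 1) by lra.
  set (V := fun t => Cmod (cderiv f (polar r t))).
  assert (IV : forall a b, is_RInt V a b (RInt V a b)).
  { intros a b. apply (RInt_correct (V := R_CompleteNormedModule)).
    apply (ex_RInt_continuous (V := R_CompleteNormedModule)). intros t _.
    apply continuous_Cmod_polar; assumption. }
  assert (V0 : forall a b, a <= b -> 0 <= RInt V a b).
  { intros a b Hab. apply (is_RInt_nonneg V a b _ Hab); [intros; apply Cmod_ge_0|apply IV]. }
  set (L := RInt V 0 (2 * PI)).
  assert (HL : L <= 4 * PI * Hp_norm p (cderiv f)).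
  { apply (RInt_Cmod_le_Hp_norm p (cderiv f) r L Hp Hd Hr). apply IV. }
  assert (Hosc : forall a b, 0 <= a -> a <= b -> b <= 2 * PI ->
    Cmod (f (polar r b) - f (polar r a)) <= L).
  { intros a b Ha Hab Hb. apply (Rle_trans _ (RInt V a b)).
    - assert (I : is_CRInt (fun t => cderiv f (0 + RtoC r * cis t) * (RtoC r * (Ci * cis t)))%C a b
                    (f (0 + RtoC r * cis b) - f (0 + RtoC r * cis a))%C).
      { apply (is_CRInt_Pderive (fun t => f (0 + RtoC r * cis t))%C); [exact Hab| |].
        - intros t _. apply Pderive_circle; [exact Hder|apply Cmod_polar_lt_1, Hr'].
        - intros t _. apply continuous_Cmult.
          + apply continuous_circle; [exact Hdf|apply Cmod_polar_lt_1, Hr'].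
          + apply continuous_Cmult; [apply continuous_Cconst|].
            apply continuous_Cmult; [apply continuous_Cconst|apply continuous_cis_1]. }
      rewrite <- !polar_circle in I.
      apply (CRInt_le _ V a b _ _ Hab) with (2 := I); [|apply IV].
      (* The circle is traversed with speed [r], which is bounded by 1. *)
      intros t _. unfold V. rewrite <- polar_circle, !Cmod_mult, Cmod_Ci, Cmod_cis, Cmod_R,
        Rabs_right by lra.
      pose proof (Cmod_ge_0 (cderiv f (polar r t))). nra.
    - pose proof (V0 0 a Ha). pose proof (V0 b (2 * PI) Hb).
      pose proof (is_RInt_unique _ _ _ _ (is_RInt_Chasles _ _ _ _ _ _ (IV 0 a)
        (is_RInt_Chasles _ _ _ _ _ _ (IV a b) (IV b (2 * PI))))) as E.
      change (L = RInt V 0 a + (RInt V a b + RInt V b (2 * PI))) in E. lra. }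
  assert (Hmean : is_CRInt (fun t => f (polar r t)) 0 (2 * PI) (RtoC (2 * PI) * f 0)%C).
  { apply (is_CRInt_ext (fun t => f (0 + RtoC r * cis t))%C _ _ _ _ two_PI_ge_0).
    { intros t _. rewrite polar_circle. reflexivity. }
    apply (mean_value f (cderiv f)); [exact Hder|exact Hdf|lra|rewrite Cmod_0; lra]. }
  pose proof (is_CRInt_minus _ _ _ _ _ _ (is_CRInt_const (f (polar r s)) 0 (2 * PI)) Hmean) as I.
  assert (B : Cmod (RtoC (2 * PI - 0) * f (polar r s) - RtoC (2 * PI) * f 0)%C
              <= (2 * PI - 0) * L).
  { apply (CRInt_bound _ 0 (2 * PI) L _ two_PI_ge_0) with (2 := I). intros t Ht.
    destruct (Rle_lt_dec s t) as [Hst|Hst].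
    - rewrite Cmod_minus_sym. apply Hosc; lra.
    - apply Hosc; lra. }
  replace (2 * PI - 0) with (2 * PI) in B by ring.
  replace (RtoC (2 * PI) * f (polar r s) - RtoC (2 * PI) * f 0)%C
    with (RtoC (2 * PI) * (f (polar r s) - f 0))%C in B by ring.
  rewrite Cmod_mult, Cmod_R, Rabs_right in B by lra.
  apply Rmult_le_reg_l in B; [|lra].
  pose proof (Cmod_minus_le (f (polar r s)) (f 0)). lra.
Qed.

(** Meant for the second derivative of [Ig g f], with [u], [a], [b], [v] being [f''], [g], [f'],
    [g']. One factor 2 of the constant comes from [rpow_plus_le]; the other absorbs the two terms,
    each at most [rpow S p], through [2 <= rpow 2 p]. *)
Lemma Hp_norm_combination (p A B : R) (h u v a b : C -> C) : 1 <= p -> analytic h ->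
  in_Hp p u -> in_Hp p v -> 0 <= A -> 0 <= B ->
  (forall z, Cmod z < 1 -> h z = (u z * a z + b z * v z)%C) ->
  (forall r t, 0 < r < 1 -> 0 <= t <= 2 * PI -> Cmod (a (polar r t)) <= A) ->
  (forall r t, 0 < r < 1 -> 0 <= t <= 2 * PI -> Cmod (b (polar r t)) <= B) ->
  in_Hp p h /\ Hp_norm p h <= 4 * (A * Hp_norm p u + B * Hp_norm p v).
Proof.
  intros Hp Hh Hu Hv HA HB E Ba Bb. pose proof PI_RGT_0 as Hpi.
  pose proof (Hp_norm_ge_0 p u) as Nu. pose proof (Hp_norm_ge_0 p v) as Nv.
  set (S := A * Hp_norm p u + B * Hp_norm p v).
  assert (H1 : 0 <= A * Hp_norm p u) by (apply Rmult_le_pos; assumption).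
  assert (H2 : 0 <= B * Hp_norm p v) by (apply Rmult_le_pos; assumption).
  apply Hp_norm_le; [exact Hp|unfold S; lra|exact Hh|].
  intros r Hr. assert (Hr' : 0 <= r < 1) by lra.
  pose proof (is_RInt_scal _ 0 (2 * PI) (rpow 2 p) _ (is_RInt_plus _ _ 0 (2 * PI) _ _
    (is_RInt_scal _ 0 (2 * PI) (rpow A p) _ (is_RInt_Mp p u r Hp (proj1 Hu) Hr'))
    (is_RInt_scal _ 0 (2 * PI) (rpow B p) _ (is_RInt_Mp p v r Hp (proj1 Hv) Hr')))) as I.
  assert (L : 2 * PI * Mp p h r <= rpow 2 p
    * (rpow A p * (2 * PI * Mp p u r) + rpow B p * (2 * PI * Mp p v r))).
  { apply (is_RInt_le _ _ 0 (2 * PI) _ _ two_PI_ge_0) with (2 := is_RInt_Mp p h r Hp Hh Hr')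
      (3 := I).
    intros t Ht. set (z := polar r t).
    change (rpow (Cmod (h z)) p
      <= rpow 2 p * (rpow A p * rpow (Cmod (u z)) p + rpow B p * rpow (Cmod (v z)) p)).
    pose proof (Cmod_ge_0 (u z)) as Pu. pose proof (Cmod_ge_0 (v z)) as Pv.
    assert (X : Cmod (h z) <= A * Cmod (u z) + B * Cmod (v z)).
    { rewrite E by (unfold z; rewrite polar_circle; apply Cmod_polar_lt_1, Hr').
      eapply Rle_trans; [apply Cmod_triangle|]. rewrite !Cmod_mult.
      specialize (Ba r t Hr Ht). specialize (Bb r t Hr Ht). fold z in Ba, Bb. nra. }
    eapply Rle_trans; [apply rpow_le; [lra|exact X]|].
    rewrite <- !rpow_mult by assumption.
    apply rpow_plus_le; [lra| |]; apply Rmult_le_pos; assumption. }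
  assert (L' : Mp p h r <= rpow 2 p * (rpow A p * Mp p u r + rpow B p * Mp p v r)).
  { apply (Rmult_le_reg_l (2 * PI)); [lra|]. lra. }
  eapply Rle_trans; [exact L'|].
  replace (4 * S) with (2 * (2 * S)) by ring.
  rewrite (rpow_mult 2 (2 * S)), (rpow_mult 2 S) by (unfold S; lra).
  apply Rmult_le_compat_l; [apply rpow_ge_0|].
  assert (G1 : rpow A p * Mp p u r <= rpow S p).
  { apply (Rle_trans _ (rpow (A * Hp_norm p u) p)); [|apply rpow_le; unfold S; lra].
    rewrite rpow_mult by assumption.
    apply Rmult_le_compat_l; [apply rpow_ge_0|apply Mp_le_Hp_norm; assumption]. }
  assert (G2 : rpow B p * Mp p v r <= rpow S p).
  { apply (Rle_trans _ (rpow (B * Hp_norm p v) p)); [|apply rpow_le; unfold S; lra].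
    rewrite rpow_mult by assumption.
    apply Rmult_le_compat_l; [apply rpow_ge_0|apply Mp_le_Hp_norm; assumption]. }
  pose proof (rpow_ge_id 2 p Hp ltac:(lra)). pose proof (rpow_ge_0 S p). nra.
Qed.

(** * Derivatives of [Ig] and the equivalence *)

Lemma analytic_mult (f g : C -> C) : analytic f -> analytic g -> analytic (fun z => f z * g z)%C.
Proof.
  intros Hf Hg. apply analytic_of_Cderive. intros z Hz. eexists.
  apply (is_derive_wrt_mult (X := Cu) (fun z => z) f g); [apply continuous_Cid| |];
    apply analytic_iff; assumption.
Qed.

(** In the disc, [Ig g f] is the primitive [seg_int] from 0 of [f' g], which is analytic because
    [f'] is. *)
Lemma Cderive_Ig (g f : C -> C) (z : C) : analytic g -> analytic f -> Cmod z < 1 ->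
  Cderive (Ig g f) z (cderiv f z * g z)%C.
Proof.
  intros Hg Hf Hz.
  apply (Cderive_ext_disc (seg_int (fun w => cderiv f w * g w)%C 0) (Ig g f) 1 _ _ Hz).
  - intros w _. apply (@RInt_ext C_R_CompleteNormedModule). intros t _. unfold segpt.
    replace (0 + RtoC t * (w - 0))%C with (RtoC t * w)%C by ring.
    replace (w - 0)%C with w by ring. reflexivity.
  - apply (analytic_primitive (fun w => cderiv f w * g w)%C); [|exact Hz].
    apply analytic_mult; [apply analytic_cderiv|]; assumption.
Qed.

Lemma cderiv_cderiv_Ig (g f : C -> C) (z : C) : analytic g -> analytic f -> Cmod z < 1 ->
  cderiv (cderiv (Ig g f)) z = (cderiv (cderiv f) z * g z + cderiv f z * cderiv g z)%C.
Proof.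
  intros Hg Hf Hz. apply Cderive_cderiv.
  apply (Cderive_ext_disc (fun w => cderiv f w * g w)%C _ 1 _ _ Hz).
  - intros w Hw. symmetry. apply Cderive_cderiv, Cderive_Ig; assumption.
  - apply (is_derive_wrt_mult (X := Cu) (fun z => z)); [apply continuous_Cid| |];
      apply analytic_iff; try assumption. apply analytic_cderiv, Hf.
Qed.

Lemma cderiv_id (z : C) : cderiv (fun w => w) z = 1%C.
Proof. apply Cderive_cderiv, (is_derive_wrt_id (X := Cu) (fun w => w)). Qed.

Lemma cderiv_cderiv_id (z : C) : cderiv (cderiv (fun w => w)) z = 0%C.
Proof.
  apply Cderive_cderiv. apply (Cderive_ext_loc (fun _ => 1%C)).
  - apply filter_forall. intros w. symmetry. apply cderiv_id.
  - apply (is_derive_wrt_const (X := Cu)).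
Qed.

Lemma in_S2p_id (p : R) : 1 <= p -> in_S2p p (fun w => w).
Proof.
  intros Hp. split.
  - apply analytic_of_Cderive. intros z _. exists 1%C.
    apply (is_derive_wrt_id (X := Cu) (fun w => w)).
  - apply (in_Hp_ext p (fun _ => 0%C)); [intros z _; symmetry; apply cderiv_cderiv_id|].
    apply (Hp_norm_le p 0); [exact Hp|lra| |].
    + apply analytic_of_Cderive. intros z _. exists 0%C. apply (is_derive_wrt_const (X := Cu)).
    + intros r Hr. unfold Mp. rewrite Cmod_0, !(rpow_neg 0) by lra.
      rewrite RInt_const. change (/ (2 * PI) * ((2 * PI - 0) * 0) <= 0). lra.
Qed.

Lemma Ig_0 (g f : C -> C) : Ig g f 0 = 0%C.
Proof.
  apply is_CRInt_unique.
  pose proof (is_CRInt_const 0%C 0 1) as I. rewrite Cmult_0_r in I.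
  revert I. apply is_CRInt_ext; [lra|]. intros t _. ring.
Qed.

Theorem theorem4p2 (p : R) (g : C -> C) :
  1 <= p -> analytic g ->
  (Ig_bounded_S2p p g <-> in_Sp p g).
Proof.
  intros Hp Hg. split.
  - intros [K HK]. destruct (HK _ (in_S2p_id p Hp)) as [[_ H] _].
    split; [exact Hg|]. revert H. apply in_Hp_ext. intros z Hz.
    rewrite cderiv_cderiv_Ig; [|exact Hg|apply (in_S2p_id p Hp)|exact Hz].
    rewrite cderiv_id, cderiv_cderiv_id. ring.
  - intros [_ Hg']. set (G := Hp_norm p (cderiv g)). set (A := Cmod (g 0) + 4 * PI * G).
    pose proof PI_RGT_0 as Hpi.
    assert (HG : 0 <= G) by apply Hp_norm_ge_0.
    assert (Hg0 : 0 <= Cmod (g 0)) by apply Cmod_ge_0.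
    assert (HA : 0 <= A) by (unfold A; nra).
    (* With [x = |f'(0)|] and [N = ||f''||], the derivative of [Ig g f] at 0 is at most [A * x], and
       its second derivative has norm at most [4 * (A * N + B * G)], where [B = x + 4 pi N] bounds
       [f'] and hence [B * G <= (1 + 4 pi) * G * (x + N)]. *)
    exists (A + 4 * (A + (1 + 4 * PI) * G)).
    intros f [Hf Hf2].
    pose proof (analytic_cderiv f Hf) as Hf'.
    set (N := Hp_norm p (cderiv (cderiv f))) in *.
    assert (HN : 0 <= N) by apply Hp_norm_ge_0.
    assert (Hf0 : 0 <= Cmod (cderiv f 0)) by apply Cmod_ge_0.
    set (B := Cmod (cderiv f 0) + 4 * PI * N).
    assert (HB : 0 <= B) by (unfold B; nra).
    assert (AI : analytic (Ig g f)).
    { apply analytic_of_Cderive. intros z Hz. eexists. apply Cderive_Ig; assumption. }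
    destruct (Hp_norm_combination p A B (cderiv (cderiv (Ig g f))) (cderiv (cderiv f))
      (cderiv g) g (cderiv f) Hp) as [H1 H2]; try assumption.
    + apply analytic_cderiv, analytic_cderiv, AI.
    + intros z Hz. apply cderiv_cderiv_Ig; assumption.
    + intros r t Hr Ht. apply Cmod_le_Hp_norm_cderiv; assumption.
    + intros r t Hr Ht. apply Cmod_le_Hp_norm_cderiv; assumption.
    + split; [split; assumption|]. unfold S2p_norm. fold N G in H2 |- *.
      rewrite Ig_0, Cmod_0.
      rewrite (Cderive_cderiv _ _ _ (Cderive_Ig g f 0 Hg Hf ltac:(rewrite Cmod_0; lra))).
      rewrite Cmod_mult.
      pose proof (Cmod_ge_0 (f 0)) as F0.
      set (x := Cmod (cderiv f 0)) in *. set (y := Cmod (f 0)) in *.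
      assert (Q0 : 0 <= 4 * PI * G /\ 0 <= 4 * PI * x)
        by (split; apply Rmult_le_pos; lra).
      assert (Q1 : x * Cmod (g 0) <= A * x) by (unfold A; nra).
      assert (Q2 : B * G <= (1 + 4 * PI) * G * (x + N)).
      { assert (0 <= (4 * PI * x + N) * G) by (apply Rmult_le_pos; lra).
        replace ((1 + 4 * PI) * G * (x + N)) with (B * G + (4 * PI * x + N) * G)
          by (unfold B; ring). lra. }
      assert (Q3 : 0 <= (1 + 4 * PI) * G) by nra.
      set (W := (1 + 4 * PI) * G) in *.
      assert (0 <= A * x /\ 0 <= A * N /\ 0 <= A * y /\ 0 <= W * y) as (?&?&?&?)
        by (repeat split; apply Rmult_le_pos; assumption).
      lra.
Qed.
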